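(* For every integer $k\ge 1$ and every $\alpha\in\mathbb{Q}\setminus\mathbb{Z}$, $$\psi_k(1-\alpha)+(-1)^{k+1}\psi_k(\alpha) = -(-1)^{\left\lfloor\frac{k+1}{2}\right\rfloor}\,\frac{(2\pi q)^{k+1}}{q\,(k+1)}\,\sum_{s=1}^{q} B_{k+1}\!\left(\frac{s}{q}\right) f_{k+1}(2\pi s\,\widetilde{\alpha}),$$ where $\widetilde{\alpha}:=\alpha-\lfloor\alpha\rfloor\in(0,1)$, $q>1$ is the denominator of $\widetilde{\alpha}$, and, for an integer $j$, $f_j(\theta)=\cos\theta$ if $j$ is even and $f_j(\theta)=\sin\theta$ if $j$ is odd. The sum is null if and only if $\alpha$ is a half-integer and $k$ is even.
   Context: $\psi_k(z)=\frac{d^k}{dz^k}\psi(z)$ is the polygamma function, where $\psi(z)=\psi_0(z)=\frac{d}{dz}\ln\Gamma(z)=\Gamma'(z)/\Gamma(z)$ is the digamma function and $\Gamma$ is the Euler gamma function (meromorphically continued, so that $\psi_k$ is defined at all real non-integers). $B_n(x)$ denotes the Bernoulli polynomial of degree $n$, defined by $\frac{t e^{tx}}{e^t-1}=\sum_{n=0}^{\infty} B_n(x)\frac{t^n}{n!}$ for $0<|t|<2\pi$. $\lfloor x\rfloor$ is the greatest integer less than or equal to $x$. The denominator of a rational number is its positive denominator in lowest terms. A half-integer is a number of the form $m+\frac12$ with $m\in\mathbb{Z}$; ''null'' means equal to $0$. *)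

(* Defs.v *)
From Stdlib Require Export Reals QArith Qround Qreals.
From Coquelicot Require Export Coquelicot.

Open Scope R_scope.

(** Euler's integral; it converges for [0 < x]. *)
Definition Gamma_integral (x : R) : R :=
  RInt_gen (fun t => Rpower t (x - 1) * exp (- t))
           (at_right 0) (Rbar_locally p_infty).

(** [rising x n = x (x + 1) ... (x + n - 1)]. *)
Fixpoint rising (x : R) (n : nat) : R :=
  match n with
  | O => 1
  | S m => rising x m * (x + INR m)
  end.

(** The restriction to the real line of the meromorphic continuation of the
    Gamma function, through [Gamma(x) = Gamma(x + n) / (x (x + 1) ... (x + n - 1))]
    with an [n] such that [0 < x + n]. The chosen shift satisfies this because
    [-x < up (-x)], and it is [0] when [0 < x]. At the poles [0, -1, -2, ...]
    the value is meaningless (it is a division by [0]). *)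
Definition Gamma_shift (x : R) : nat := Z.to_nat (up (- x)).

Definition Gamma (x : R) : R :=
  Gamma_integral (x + INR (Gamma_shift x)) / rising x (Gamma_shift x).

(** The logarithmic derivative is written as the quotient [Gamma' / Gamma],
    because [Gamma] takes negative values on the negative half-line, where the
    real logarithm [ln] is not available. *)
Definition digamma (x : R) : R := Derive Gamma x / Gamma x.

Definition polygamma (k : nat) (x : R) : R := Derive_n digamma k x.

(** [t e^(t x) / (e^t - 1)], with its removable singularity at [t = 0] filled. *)
Definition bernoulli_gf (x t : R) : R :=
  if Req_EM_T t 0 then 1 else t * exp (t * x) / (exp t - 1).

(** [B_n(x)] is the coefficient of [t^n / n!] in the expansion of the generating
    function at [t = 0]. *)
Definition bernoulli (n : nat) (x : R) : R := Derive_n (bernoulli_gf x) n 0.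

Definition f_trig (j : nat) (theta : R) : R :=
  if Nat.even j then cos theta else sin theta.

Definition Qfrac (a : Q) : Q := (a - inject_Z (Qfloor a))%Q.

(** Elements of [Q] need not be in lowest terms, hence the [Qred]. *)
Definition Qdenom (a : Q) : nat := Pos.to_nat (Qden (Qred a)).

Definition is_integer (a : Q) : Prop := exists m : Z, (a == inject_Z m)%Q.

Definition is_half_integer (a : Q) : Prop :=
  exists m : Z, (a == inject_Z m + (1 # 2))%Q.

(* Main.v *)
Require Import Defs.
From Stdlib Require Import Reals QArith ZArith Factorial Lra Lia.
From Coquelicot Require Import Coquelicot.
Open Scope R_scope.

(** Write [hurwitz m x] for the sum of [1 / (x + n)^m] over [n >= 0], and
    [bilateral m x] for the sum of [1 / (x + n)^m] over all integers [n]. The proof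
    identifies both sides of the formula with [k! * bilateral (k + 1) alpha].

    The polygamma side. Euler's integral satisfies [Gamma (x + 1) = x Gamma (x)] and
    Wendel's inequality [Gamma (x + s) <= x^s Gamma (x)] for [0 <= s <= 1], a pointwise
    consequence of the convexity of the exponential. Together they squeeze
    [Gamma (x + n)] against [n! n^(x - 1)] and yield Gauss's formula, that is, an
    expansion of [ln Gamma] into a series of elementary functions
    ([is_series_ln_Gamma]). The second derivatives of its terms are [1 / (x + n)^2],
    which is summable, so that the series can be differentiated term by term
    ([Series_derive]); the result is
    [psi_k (x) = (-1)^(k + 1) k! hurwitz (k + 1) x], first for [0 < x] and then, by
    the functional equation, away from the poles ([polygamma_hurwitz]). Hence the left
    side is [k! * bilateral (k + 1) alpha]. Since [bilateral] has period [1], [alpha]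
    may be replaced by its fractional part [x].

    Passing to the cotangent. Herglotz's argument shows
    [bilateral 2 x = (PI / sin (PI x))^2] ([bilateral_2_sin]): the difference [d] of
    the two functions is bounded on [(0, 1)] and satisfies
    [d (x / 2) + d ((x + 1) / 2) = 4 d x], which halves any bound on [d]. As
    [cot' = - (1 + cot^2)], further differentiation gives
    [k! * bilateral (k + 1) x = (-1)^k PI^(k + 1) P_k (cot (PI x))], where [P_0 = X]
    and [P_(k + 1) = - (1 + X^2) P_k'] ([bilateral_cot]).

    The Bernoulli side. Let [w = exp (2 PI i x)], so that [w^q = 1], and
    [r (t) = exp (t / q) w]. A geometric sum shows that the generating functions
    [t e^(t s / q) / (e^t - 1)], weighted by [w^s] and summed over [s = 1, ..., q], add
    up to [t r / (r - 1)], because [r^q = e^t] ([sum_bernoulli_gf]). Now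
    [r / (r - 1) = 1/2 - (i/2) v], where [v] is the cotangent taken along the vertical
    line through [PI x]. It satisfies the same differential equation as
    [cot (PI x)], with [PI] replaced by [- i / (2 q)], so its derivatives at [0] are
    [(- i / (2 q))^k P_k (cot (PI x))] with the same polynomials ([sum_bernoulli]).
    The real or the imaginary part of the resulting identity, according to the parity
    of [k], is the formula.

    The sum vanishes. It is a nonzero multiple of [bilateral (k + 1) x]. If [k + 1] is
    even, this is a sum of positive terms. If [k + 1] is odd, it is
    [hurwitz (k + 1) x - hurwitz (k + 1) (1 - x)], and [hurwitz] is strictly
    decreasing, so it vanishes exactly at [x = 1/2] ([bilateral_eq_0]). *)

(** Canonical structures leave equations typed in the carrier of a module, where
    [field] and [ring] do not recognize the real or complex field. *)
Ltac eq_in_R := match goal with |- @eq _ ?a ?b => change (@eq R a b) end.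
Ltac eq_in_C := match goal with |- @eq _ ?a ?b => change (@eq C a b) end.

(** * Euler's integral and Wendel's inequality *)

(** The limit is the supremum of the proper integrals: they grow with the interval
    because [f] is nonnegative. *)
Lemma is_RInt_gen_bounded (f : R -> R) (M : R) :
  (forall t, 0 < t -> 0 <= f t) ->
  (forall a b, 0 < a -> a <= b -> ex_RInt f a b) ->
  (forall a b, 0 < a -> a <= b -> RInt f a b <= M) ->
  exists l, is_RInt_gen f (at_right 0) (Rbar_locally p_infty) l.
Proof.
intros Hpos Hex HM.
destruct (completeness (fun y => exists a b, 0 < a /\ a <= b /\ y = RInt f a b))
  as [l [Hub Hlub]].
{ exists M; intros y (a & b & Ha & Hab & ->); now apply HM. }
{ exists (RInt f 1 1), 1, 1; repeat split; lra. }
exists l; intros P [eps HP].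
assert (Hnear : exists a b, 0 < a /\ a <= b /\ l - eps < RInt f a b).
{ destruct (Classical_Prop.classic
    (exists a b, 0 < a /\ a <= b /\ l - eps < RInt f a b)) as [H|H]; [exact H|].
  exfalso; assert (l <= l - eps) by
    (apply Hlub; intros y (a & b & Ha & Hab & ->);
     destruct (Rle_lt_dec (RInt f a b) (l - eps)); [assumption|];
     exfalso; apply H; now exists a, b).
  destruct eps as [e He]; simpl in *; lra. }
destruct Hnear as (a0 & b0 & Ha0 & Hab0 & Hl).
apply Filter_prod with (fun a => 0 < a /\ a < a0) (fun b => b0 < b).
{ exists (mkposreal a0 Ha0); intros y Hy Hy0.
  unfold ball in Hy; simpl in Hy; unfold AbsRing_ball, abs, minus, plus, opp in Hy.
  simpl in Hy; apply Rabs_def2 in Hy; lra. }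
{ exists b0; now intros y Hy. }
intros a b [Ha Haa] Hb; simpl.
exists (RInt f a b); split.
{ apply (RInt_correct f); apply Hex; lra. }
apply HP; unfold ball; simpl; unfold AbsRing_ball, abs, minus, plus, opp; simpl.
assert (RInt f a b <= l) by (apply Hub; exists a, b; repeat split; lra).
assert (E : RInt f a b = RInt f a a0 + (RInt f a0 b0 + RInt f b0 b)).
{ rewrite <- (RInt_Chasles f a a0 b), <- (RInt_Chasles f a0 b0 b);
    try reflexivity; apply Hex; lra. }
assert (0 <= RInt f a a0) by
  (apply RInt_ge_0; [lra | apply Hex; lra | intros; apply Hpos; lra]).
assert (0 <= RInt f b0 b) by
  (apply RInt_ge_0; [lra | apply Hex; lra | intros; apply Hpos; lra]).
apply Rabs_def1; lra.
Qed.

Lemma ln_le_sub_1 (u : R) : 0 < u -> ln u <= u - 1.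
Proof.
intros Hu; pose proof (exp_ineq1_le (ln u)) as H; rewrite exp_ln in H; lra.
Qed.

(** From [c * ln (t / c) <= t - c]. *)
Lemma Rpower_le_exp (c t : R) :
  0 < c -> 0 < t -> Rpower t c <= Rpower c c * exp t.
Proof.
intros Hc Ht; unfold Rpower; rewrite <- exp_plus.
assert (H : c * ln t <= c * ln c + t).
{ pose proof (ln_le_sub_1 (t / c) ltac:(apply Rdiv_lt_0_compat; lra)) as H.
  rewrite ln_div in H by lra.
  apply (Rmult_le_compat_l c) in H; [|lra].
  replace (c * (t / c - 1)) with (t - c) in H by (field; lra). lra. }
destruct (Rle_lt_or_eq_dec _ _ H) as [H'|H'];
  [left; now apply exp_increasing | right; now rewrite H'].
Qed.

Definition gamma_kernel (x t : R) : R := Rpower t (x - 1) * exp (- t).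

Lemma gamma_kernel_pos (x t : R) : 0 < gamma_kernel x t.
Proof. apply Rmult_lt_0_compat; apply exp_pos. Qed.

Lemma gamma_kernel_continuous (x t : R) : 0 < t -> continuous (gamma_kernel x) t.
Proof.
intros Ht; apply (ex_derive_continuous (gamma_kernel x)).
unfold gamma_kernel, Rpower; auto_derive; lra.
Qed.

Lemma Rpower_pred (x t : R) : 0 < t -> Rpower t (x - 1) = Rpower t x / t.
Proof.
intros Ht; unfold Rminus; rewrite Rpower_plus, Rpower_Ropp, Rpower_1; auto.
Qed.

Lemma gamma_kernel_ex_RInt (x a b : R) :
  0 < a -> a <= b -> ex_RInt (gamma_kernel x) a b.
Proof.
intros Ha Hb; apply (ex_RInt_continuous (gamma_kernel x)); intros z.
rewrite Rmin_left by lra; intros Hz; apply gamma_kernel_continuous; lra.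
Qed.

(** On the whole half-line [t^(x - 1) e^(-t)] is dominated by a multiple of the
    derivative of the bounded function [- 1 / (1 + t^x)], because
    [(1 + t^x)^2 e^(-t)] is bounded. One majorant thus handles both ends. *)
Lemma gamma_kernel_RInt_bounded (x : R) : 0 < x ->
  exists M, forall a b, 0 < a -> a <= b -> RInt (gamma_kernel x) a b <= M.
Proof.
intros Hx.
(* [t^(2 x) <= K e^t], and [(1 + T)^2 <= 2 + 2 T^2] for [T = t^x]. *)
set (K := Rpower (2 * x) (2 * x)).
set (C := (2 + 2 * K) / x).
assert (HK : 0 < K) by apply exp_pos.
assert (HC : 0 < C) by (apply Rdiv_lt_0_compat; lra).
set (H := fun t => - C / (1 + Rpower t x)).
set (h := fun t => C * x * (Rpower t x / t) / (1 + Rpower t x) ^ 2).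
assert (Hd : forall t, 0 < t -> is_derive H t (h t)).
{ intros t Ht; unfold H, h, Rpower; pose proof (exp_pos (x * ln t)).
  auto_derive; [split; lra|]. field; lra. }
assert (Hc : forall t, 0 < t -> continuous h t).
{ intros t Ht; apply (ex_derive_continuous h); unfold h, Rpower.
  pose proof (exp_pos (x * ln t)).
  auto_derive; repeat split; try lra.
  rewrite Rmult_1_r; apply Rgt_not_eq, Rmult_lt_0_compat; lra. }
exists C; intros a b Ha Hab.
assert (HI : is_RInt h a b (H b - H a)).
{ apply (is_RInt_derive H h); intros t; rewrite Rmin_left by lra;
    intros Ht; [apply Hd | apply Hc]; lra. }
apply Rle_trans with (H b - H a).
- rewrite <- (is_RInt_unique _ _ _ _ HI).
  apply RInt_le; [lra | now apply gamma_kernel_ex_RInt | eexists; apply HI |].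
  intros t Ht; unfold gamma_kernel, h.
  rewrite Rpower_pred by lra.
  pose proof (exp_pos (x * ln t)) as HT; fold (Rpower t x) in HT.
  assert (HB : (1 + Rpower t x) ^ 2 * exp (- t) <= C * x).
  { replace (C * x) with (2 + 2 * K) by (unfold C; field; lra).
    pose proof (Rpower_le_exp (2 * x) t ltac:(lra) ltac:(lra)) as H2.
    fold K in H2.
    replace (Rpower t (2 * x)) with (Rpower t x * Rpower t x) in H2
      by (rewrite <- Rpower_plus; f_equal; ring).
    apply (Rmult_le_compat_r (exp (- t))) in H2; [|left; apply exp_pos].
    rewrite (Rmult_assoc K), <- exp_plus, Rplus_opp_r, exp_0 in H2.
    assert (exp (- t) <= 1) by
      (rewrite <- exp_0; left; apply exp_increasing; lra).
    assert (0 < exp (- t)) by apply exp_pos.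
    assert (0 <= (Rpower t x - 1) ^ 2 * exp (- t)) by
      (apply Rmult_le_pos; [apply pow2_ge_0 | lra]).
    simpl in *; lra. }
  apply (Rmult_le_reg_r ((1 + Rpower t x) ^ 2)); [apply pow_lt; lra|].
  unfold Rdiv at 2; rewrite (Rmult_assoc _ (/ _)), Rinv_l
    by (apply pow_nonzero; lra).
  replace (Rpower t x / t * exp (- t) * (1 + Rpower t x) ^ 2)
    with ((1 + Rpower t x) ^ 2 * exp (- t) * (Rpower t x / t)) by ring.
  rewrite Rmult_1_r; apply Rmult_le_compat_r; [|lra].
  apply Rlt_le, Rdiv_lt_0_compat; lra.
- unfold H.
  assert (B : forall t, 0 < C / (1 + Rpower t x) <= C).
  { intros t; pose proof (exp_pos (x * ln t)) as HT; fold (Rpower t x) in HT.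
    split; [apply Rdiv_lt_0_compat; lra|].
    apply (Rmult_le_reg_r (1 + Rpower t x)); [lra|].
    replace (C / (1 + Rpower t x) * (1 + Rpower t x)) with C by (field; lra).
    rewrite <- (Rmult_1_r C) at 1; apply Rmult_le_compat_l; lra. }
  pose proof (B a); pose proof (B b); unfold Rdiv in *; lra.
Qed.

Lemma Gamma_integral_correct (x : R) : 0 < x ->
  is_RInt_gen (gamma_kernel x) (at_right 0) (Rbar_locally p_infty)
    (Gamma_integral x).
Proof.
intros Hx; destruct (gamma_kernel_RInt_bounded x Hx) as [M HM].
destruct (is_RInt_gen_bounded (gamma_kernel x) M) as [l Hl]; auto.
- intros; left; apply gamma_kernel_pos.
- intros; now apply gamma_kernel_ex_RInt.
- unfold Gamma_integral.
  fold (gamma_kernel x).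
  apply (RInt_gen_correct (V := R_CompleteNormedModule) (gamma_kernel x)).
  now exists l.
Qed.

Lemma Gamma_integral_eq (x l : R) :
  is_RInt_gen (gamma_kernel x) (at_right 0) (Rbar_locally p_infty) l ->
  Gamma_integral x = l.
Proof.
intros H; unfold Gamma_integral; fold (gamma_kernel x).
apply (is_RInt_gen_unique (V := R_CompleteNormedModule) (gamma_kernel x)), H.
Qed.

Lemma at_right_infty_pos : filter_prod (at_right 0) (Rbar_locally p_infty)
  (fun ab : R * R => 0 < fst ab <= 1 /\ 1 <= snd ab).
Proof.
apply Filter_prod with (fun a => 0 < a < 1) (fun b => 1 < b).
- exists (mkposreal 1 Rlt_0_1); intros y Hy Hy0.
  unfold ball in Hy; simpl in Hy; unfold AbsRing_ball, abs, minus, plus, opp in Hy.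
  simpl in Hy; apply Rabs_def2 in Hy; lra.
- exists 1; auto.
- simpl; intros; lra.
Qed.

Lemma is_RInt_gen_antiderivative (F f : R -> R) (la lb : R) :
  (forall t, 0 < t -> is_derive F t (f t)) ->
  (forall t, 0 < t -> continuous f t) ->
  filterlim F (at_right 0) (locally la) ->
  filterlim F (Rbar_locally p_infty) (locally lb) ->
  is_RInt_gen f (at_right 0) (Rbar_locally p_infty) (lb - la).
Proof.
intros Hd Hc Ha Hb.
apply (is_RInt_gen_ext (V := R_NormedModule) (Derive F)).
- eapply filter_imp; [|apply at_right_infty_pos].
  intros [a b]; simpl; intros Hab t; rewrite Rmin_left by lra; intros Ht.
  apply is_derive_unique, Hd; lra.
- apply is_RInt_gen_Derive; auto; (eapply filter_imp; [|apply at_right_infty_pos]);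
  intros [a b]; simpl; intros Hab t; rewrite Rmin_left by lra; intros Ht.
  + eexists; apply Hd; lra.
  + apply (continuous_ext_loc _ f); [|apply Hc; lra].
    exists (mkposreal t ltac:(lra)); intros y Hy.
    symmetry; apply is_derive_unique, Hd.
    unfold ball in Hy; simpl in Hy; unfold AbsRing_ball, abs, minus, plus, opp in Hy.
    simpl in Hy; apply Rabs_def2 in Hy; lra.
Qed.

Lemma is_lim_filterlim_p (F : R -> R) (l : R) :
  is_lim F p_infty l -> filterlim F (Rbar_locally p_infty) (locally l).
Proof. intros H P HP; exact (H P HP). Qed.

Lemma exp_opp_lim : filterlim (fun t => exp (- t)) (Rbar_locally p_infty) (locally 0).
Proof.
apply is_lim_filterlim_p.
apply (is_lim_comp exp Ropp p_infty 0 m_infty); [apply is_lim_exp_m | |].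
- apply (is_lim_opp (fun t => t) p_infty p_infty), is_lim_id.
- exists 0; discriminate.
Qed.

Lemma Gamma_integral_1 : Gamma_integral 1 = 1.
Proof.
apply Gamma_integral_eq.
replace 1 with (- 0 - - 1) at 2 by ring.
apply (is_RInt_gen_antiderivative (fun t => - exp (- t))).
- intros t Ht; unfold gamma_kernel.
  replace (1 - 1) with 0 by ring; rewrite Rpower_O by assumption.
  auto_derive; [auto | ring].
- intros t Ht; now apply gamma_kernel_continuous.
- apply (filterlim_filter_le_1 (F := locally 0)); [apply filter_le_within|].
  replace (- 1) with (- exp (- 0)) by (rewrite Ropp_0, exp_0; ring).
  apply (ex_derive_continuous (fun t => - exp (- t))); auto_derive; auto.
- apply (filterlim_comp _ _ _ _ Ropp _ (locally 0)); [apply exp_opp_lim|].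
  apply (filterlim_opp (V := R_NormedModule) 0).
Qed.

Lemma Rpower_lim_0 (x : R) : 0 < x ->
  filterlim (fun t => Rpower t x) (at_right 0) (locally 0).
Proof.
intros Hx P [e He].
exists (mkposreal (Rpower e (/ x)) ltac:(apply exp_pos)); intros y Hy Hy0.
unfold ball in Hy; simpl in Hy; unfold AbsRing_ball, abs, minus, plus, opp in Hy.
simpl in Hy; apply Rabs_def2 in Hy.
apply He; unfold ball; simpl; unfold AbsRing_ball, abs, minus, plus, opp; simpl.
pose proof (exp_pos (x * ln y)) as H; fold (Rpower y x) in H.
rewrite Ropp_0, Rplus_0_r, Rabs_pos_eq by lra.
replace (pos e) with (Rpower (Rpower e (/ x)) x).
- apply Rlt_Rpower_l; [lra|]; lra.
- rewrite Rpower_mult, Rinv_l, Rpower_1 by (try lra; apply cond_pos); auto.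
Qed.

Lemma Rpower_exp_lim (x : R) : 0 < x ->
  filterlim (fun t => Rpower t x * exp (- t)) (Rbar_locally p_infty) (locally 0).
Proof.
intros Hx P [e He]; set (K := Rpower (x + 1) (x + 1)).
assert (HK : 0 < K) by apply exp_pos.
exists (Rmax 1 (K / e)); intros t Ht.
pose proof (Rmax_l 1 (K / e)); pose proof (Rmax_r 1 (K / e)).
apply He; unfold ball; simpl; unfold AbsRing_ball, abs, minus, plus, opp; simpl.
pose proof (gamma_kernel_pos (x + 1) t) as H1; unfold gamma_kernel in H1.
replace (x + 1 - 1) with x in H1 by ring.
rewrite Ropp_0, Rplus_0_r, Rabs_pos_eq by lra.
pose proof (Rpower_le_exp (x + 1) t ltac:(lra) ltac:(lra)) as H2; fold K in H2.
rewrite Rpower_plus, Rpower_1 in H2 by lra.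
apply (Rmult_le_compat_r (exp (- t))) in H2; [|left; apply exp_pos].
rewrite (Rmult_assoc K), <- exp_plus, Rplus_opp_r, exp_0, Rmult_1_r in H2.
assert (He0 := cond_pos e).
apply (Rmult_lt_reg_r t); [lra|].
apply Rle_lt_trans with K; [lra|].
apply (Rmult_lt_reg_r (/ e)); [now apply Rinv_0_lt_compat|].
replace (e * t * / e) with t by (field; lra). unfold Rdiv in *; lra.
Qed.

(** Integration by parts: [- t^x e^(-t)] vanishes at both ends. *)
Lemma Gamma_integral_succ (x : R) : 0 < x ->
  Gamma_integral (x + 1) = x * Gamma_integral x.
Proof.
intros Hx.
assert (H : is_RInt_gen (fun t => minus (gamma_kernel (x + 1) t) (scal x (gamma_kernel x t)))
  (at_right 0) (Rbar_locally p_infty) (- 0 - - 0)).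
{ apply (is_RInt_gen_antiderivative (fun t => - (Rpower t x * exp (- t)))).
  - intros t Ht.
    change (is_derive (fun t => - (Rpower t x * exp (- t))) t
       (gamma_kernel (x + 1) t - x * gamma_kernel x t)); unfold gamma_kernel.
    replace (x + 1 - 1) with x by ring; rewrite Rpower_pred by assumption.
    unfold Rpower; auto_derive; [assumption|field; lra].
  - intros t Ht; apply (continuous_minus (V := R_NormedModule));
      [|apply (continuous_scal_r (V := R_NormedModule))];
      now apply gamma_kernel_continuous.
  - apply (filterlim_comp _ _ _ _ Ropp _ (locally 0)).
    + replace 0 with (0 * exp (- 0)) at 2 by ring.
      apply (filterlim_comp_2 (G := locally 0) (H := locally (exp (- 0)))).
      * now apply Rpower_lim_0.
      * apply (filterlim_filter_le_1 (F := locally 0)); [apply filter_le_within|].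
        apply (ex_derive_continuous (fun t => exp (- t))); auto_derive; auto.
      * apply (filterlim_mult (K := R_AbsRing) 0 (exp (- 0))).
    + apply (filterlim_opp (V := R_NormedModule) 0).
  - apply (filterlim_comp _ _ _ _ Ropp _ (locally 0)); [now apply Rpower_exp_lim|].
    apply (filterlim_opp (V := R_NormedModule) 0). }
pose proof (is_RInt_gen_minus (V := R_NormedModule)
  (Fa := at_right 0) (Fb := Rbar_locally p_infty) _ _ _ _
  (Gamma_integral_correct (x + 1) ltac:(lra))
  (is_RInt_gen_scal (V := R_NormedModule)
    (Fa := at_right 0) (Fb := Rbar_locally p_infty) _ x _
    (Gamma_integral_correct x Hx))) as H'.
apply (is_RInt_gen_unique (V := R_CompleteNormedModule)) in H.
apply (is_RInt_gen_unique (V := R_CompleteNormedModule)) in H'.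
pose proof (eq_trans (eq_sym H) H') as E.
unfold minus, plus, opp, scal in E; simpl in E; unfold mult in E; simpl in E; lra.
Qed.

(** Convexity of [exp] between [0] and [y]: average, with weights [s] and [1 - s], the
    tangent-line inequalities at [s * y]. *)
Lemma exp_convex_0 (s y : R) : 0 <= s <= 1 -> exp (s * y) <= s * exp y + (1 - s).
Proof.
intros Hs; pose proof (exp_pos (s * y)) as H0.
pose proof (exp_ineq1_le ((1 - s) * y)) as H1.
pose proof (exp_ineq1_le (- (s * y))) as H2.
apply (Rmult_le_compat_l (exp (s * y))) in H1; [|lra].
apply (Rmult_le_compat_l (exp (s * y))) in H2; [|lra].
rewrite <- exp_plus in H1, H2.
replace (s * y + (1 - s) * y) with y in H1 by ring.
rewrite Rplus_opp_r, exp_0 in H2.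
apply (Rmult_le_compat_l s) in H1; [|lra].
apply (Rmult_le_compat_l (1 - s)) in H2; lra.
Qed.

Lemma is_RInt_gen_mono (f g : R -> R) (l m : R) :
  (forall t, 0 < t -> 0 <= f t <= g t) ->
  is_RInt_gen f (at_right 0) (Rbar_locally p_infty) l ->
  is_RInt_gen g (at_right 0) (Rbar_locally p_infty) m -> l <= m.
Proof.
intros Hfg Hf Hg; apply Rle_trans with (1 := Rle_abs _).
apply (RInt_gen_norm (V := R_CompleteNormedModule)
  (Fa := at_right 0) (Fb := Rbar_locally p_infty) f g l m); auto;
(eapply filter_imp; [|apply at_right_infty_pos]); intros [a b] Hab; simpl in *.
- lra.
- intros t Ht; unfold norm; simpl; unfold abs; simpl.
  rewrite Rabs_pos_eq; apply Hfg; lra.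
Qed.

(** Wendel's inequality. Integrate the pointwise bound
    [t^s <= x^s (s * (t / x) + (1 - s))] against the kernel; the choice of [x] as the
    point of tangency makes the two integrals combine to [x^s Gamma (x)], through
    [Gamma (x + 1) = x Gamma (x)]. *)
Lemma Gamma_integral_wendel (x s : R) : 0 < x -> 0 <= s <= 1 ->
  Gamma_integral (x + s) <= Rpower x s * Gamma_integral x.
Proof.
intros Hx Hs.
set (c := Rpower x s).
assert (Hc : 0 < c) by apply exp_pos.
assert (Hint : is_RInt_gen (fun t => plus (scal (c * (1 - s)) (gamma_kernel x t))
    (scal (c * s / x) (gamma_kernel (x + 1) t)))
  (at_right 0) (Rbar_locally p_infty)
  (plus (scal (c * (1 - s)) (Gamma_integral x))
        (scal (c * s / x) (Gamma_integral (x + 1))))).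
{ apply (is_RInt_gen_plus (V := R_NormedModule));
  apply (is_RInt_gen_scal (V := R_NormedModule));
  apply Gamma_integral_correct; lra. }
pose proof (Gamma_integral_correct (x + s) ltac:(lra)) as Hl.
assert (E : plus (scal (c * (1 - s)) (Gamma_integral x))
    (scal (c * s / x) (Gamma_integral (x + 1))) = c * Gamma_integral x).
{ rewrite Gamma_integral_succ by assumption.
  unfold scal, plus; simpl; unfold mult; simpl; field; lra. }
rewrite <- E.
eapply is_RInt_gen_mono; [|exact Hl|exact Hint].
intros t Ht; split; [left; apply gamma_kernel_pos|].
unfold scal, plus; simpl; unfold mult; simpl.
  assert (H1 : Rpower t s <= c * (s * (t / x) + (1 - s))).
  { replace t with (x * (t / x)) at 1 by (field; lra).
    rewrite <- Rpower_mult_distr by (try apply Rdiv_lt_0_compat; lra).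
    apply Rmult_le_compat_l; [lra|].
    unfold Rpower; eapply Rle_trans; [now apply exp_convex_0|].
    rewrite exp_ln by (apply Rdiv_lt_0_compat; lra); lra. }
unfold gamma_kernel.
  replace (x + s - 1) with (x - 1 + s) by ring.
  replace (x + 1 - 1) with (x - 1 + 1) by ring.
  rewrite !Rpower_plus, (Rpower_1 t) by lra.
  apply (Rmult_le_compat_l (gamma_kernel x t)) in H1; [|left; apply gamma_kernel_pos].
  unfold gamma_kernel in H1.
  eapply Rle_trans; [|eapply Rle_trans; [exact H1|]]; right; [ring|].
  field; lra.
Qed.

(** On [(0, 1]] Wendel's inequality with [s = 1 - y] reads
    [1 = Gamma (1) <= y^(1 - y) Gamma (y)]. *)
Lemma Gamma_integral_pos (x : R) : 0 < x -> 0 < Gamma_integral x.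
Proof.
assert (H : forall n y, 0 < y <= INR n + 1 -> 0 < Gamma_integral y).
{ induction n as [|n IH]; intros y Hy.
  - simpl in Hy.
    pose proof (Gamma_integral_wendel y (1 - y) ltac:(lra) ltac:(lra)) as H.
    replace (y + (1 - y)) with 1 in H by ring; rewrite Gamma_integral_1 in H.
    apply (Rmult_lt_reg_l (Rpower y (1 - y))); [apply exp_pos | lra].
  - rewrite S_INR in Hy; destruct (Rle_lt_dec y 1) as [H1|H1].
    + apply IH; pose proof (pos_INR n); lra.
    + replace y with (y - 1 + 1) by ring; rewrite Gamma_integral_succ by lra.
      apply Rmult_lt_0_compat; [|apply IH]; lra. }
intros Hx; destruct (nfloor_ex x ltac:(lra)) as [n Hn]; apply (H n); lra.
Qed.

(** * Termwise differentiation and the Hurwitz zeta function *)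

(** Applying the mean value theorem twice loses a factor 2 against Taylor's formula but
    asks nothing of [f''] beyond the bound. *)
Lemma taylor_remainder_bound (f f' f'' : R -> R) (a b M : R) :
  (forall t, a < t < b -> is_derive f t (f' t)) ->
  (forall t, a < t < b -> is_derive f' t (f'' t)) ->
  (forall t, a < t < b -> Rabs (f'' t) <= M) ->
  forall x y, a < x < b -> a < y < b ->
  Rabs (f y - f x - (y - x) * f' x) <= M * (y - x) ^ 2.
Proof.
intros Hf Hf' HM x y Hx Hy.
assert (mvt : forall g g', (forall t, a < t < b -> is_derive g t (g' t)) ->
  forall u v, a < u < b -> a < v < b ->
  exists c, Rmin u v <= c <= Rmax u v /\ g v - g u = g' c * (v - u)).
{ intros g g' Hg u v Hu Hv.
  assert (Huv : forall t, Rmin u v <= t <= Rmax u v -> a < t < b).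
  { intros t; unfold Rmin, Rmax; destruct Rle_dec; lra. }
  apply MVT_gen.
  - intros t Ht; apply Hg, Huv; lra.
  - intros t Ht; apply continuity_pt_filterlim, (ex_derive_continuous g).
    eexists; apply Hg, Huv, Ht. }
assert (Hin : forall u v c, a < u < b -> a < v < b ->
  Rmin u v <= c <= Rmax u v -> a < c < b /\ Rabs (c - u) <= Rabs (v - u)).
{ intros u v c Hu Hv; unfold Rmin, Rmax; destruct Rle_dec; intros Hc;
  (split; [lra|]); unfold Rabs; destruct Rcase_abs; destruct Rcase_abs; lra. }
destruct (mvt f f' Hf x y Hx Hy) as (c & Hc & Ec).
destruct (Hin x y c Hx Hy Hc) as [Hcab Hcx].
destruct (mvt f' f'' Hf' x c Hx Hcab) as (d & Hd & Ed).
destruct (Hin x c d Hx Hcab Hd) as [Hdab _].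
replace (f y - f x - (y - x) * f' x) with ((f' c - f' x) * (y - x))
  by (rewrite Ec; ring).
rewrite Ed, !Rabs_mult.
rewrite <- (pow2_abs (y - x)).
pose proof (Rabs_pos (f'' d)); pose proof (Rabs_pos (c - x)).
pose proof (Rabs_pos (y - x)); pose proof (HM d Hdab).
simpl; rewrite Rmult_1_r, Rmult_assoc.
apply Rmult_le_compat; try assumption.
- now apply Rmult_le_pos.
- apply Rmult_le_compat; try assumption; lra.
Qed.

Lemma is_derive_quadratic_bound (F : R -> R) (x l r K : R) : 0 < r ->
  (forall y, Rabs (y - x) < r -> Rabs (F y - F x - (y - x) * l) <= K * (y - x) ^ 2) ->
  is_derive F x l.
Proof.
intros Hr HK; apply is_derive_Reals; intros eps Heps.
assert (Hd : 0 < Rmin r (eps / (Rabs K + 1))).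
{ pose proof (Rabs_pos K); apply Rmin_pos; [assumption|].
  apply Rdiv_lt_0_compat; lra. }
exists (mkposreal _ Hd); intros h Hh0 Hh; simpl in Hh.
pose proof (Rmin_l r (eps / (Rabs K + 1))); pose proof (Rmin_r r (eps / (Rabs K + 1))).
specialize (HK (x + h)); replace (x + h - x) with h in HK by ring.
specialize (HK ltac:(lra)).
replace ((F (x + h) - F x) / h - l) with ((F (x + h) - F x - h * l) / h) by (field; assumption).
unfold Rdiv at 1; rewrite Rabs_mult, Rabs_inv.
assert (Hp : 0 < Rabs h) by now apply Rabs_pos_lt.
apply (Rmult_lt_reg_r (Rabs h)); [assumption|].
rewrite Rmult_assoc, Rinv_l, Rmult_1_r by lra.
apply Rle_lt_trans with (1 := HK).
rewrite <- (pow2_abs h); simpl; rewrite Rmult_1_r, <- Rmult_assoc.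
apply Rmult_lt_compat_r; [assumption|].
pose proof (Rabs_pos K); pose proof (Rle_abs K).
apply Rle_lt_trans with (Rabs K * Rabs h).
- apply Rmult_le_compat_r; lra.
- apply Rle_lt_trans with (Rabs K * (eps / (Rabs K + 1))).
  + apply Rmult_le_compat_l; lra.
  + apply (Rmult_lt_reg_r (Rabs K + 1)); [lra|].
    replace (Rabs K * (eps / (Rabs K + 1)) * (Rabs K + 1)) with (Rabs K * eps) by (field; lra).
    lra.
Qed.

(** Termwise differentiation. A summable bound on the second derivatives suffices, and
    the convergence of the derived series is part of the conclusion: the difference
    quotient of the sum differs from the sum of the [f' n x] by the Taylor remainders,
    which add up to at most [Series M * |y - x|]. *)
Lemma Series_derive (f f' f'' : nat -> R -> R) (a b : R) (M : nat -> R) :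
  (forall n t, a < t < b -> is_derive (f n) t (f' n t)) ->
  (forall n t, a < t < b -> is_derive (f' n) t (f'' n t)) ->
  (forall n t, a < t < b -> Rabs (f'' n t) <= M n) ->
  ex_series M ->
  (forall t, a < t < b -> ex_series (fun n => f n t)) ->
  forall x, a < x < b ->
    ex_series (fun n => f' n x) /\
    is_derive (fun y => Series (fun n => f n y)) x (Series (fun n => f' n x)).
Proof.
intros Hf Hf' HM HsM Hs x Hx.
set (rem := fun y n => f n y - f n x - (y - x) * f' n x).
assert (Hrem : forall y n, a < y < b -> Rabs (rem y n) <= M n * (y - x) ^ 2).
{ intros y n Hy; apply taylor_remainder_bound with (f'' := f'' n) (a := a) (b := b); auto. }
assert (HsMy : forall y, ex_series (fun n => M n * (y - x) ^ 2)).
{ intros y; now apply ex_series_scal_r. }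
assert (Hsrem : forall y, a < y < b -> ex_series (rem y)).
{ intros y Hy; apply (ex_series_le (V := R_CompleteNormedModule)) with (2 := HsMy y).
  intros n; now apply Hrem. }
assert (Hs' : ex_series (fun n => f' n x)).
{ (* Two values of the sum determine the derived series up to the remainders. *)
  set (y := (x + b) / 2); assert (Hy : a < y < b) by (unfold y; lra).
  assert (Hyx : y - x <> 0) by (unfold y; lra).
  apply ex_series_ext with (fun n => (f n y - f n x - rem y n) * / (y - x)).
  - intros n; unfold rem.
    change ((f n y - f n x - (f n y - f n x - (y - x) * f' n x)) * / (y - x) = f' n x).
    field; assumption.
  - apply ex_series_scal_r, (ex_series_minus (V := R_NormedModule)); [|now apply Hsrem].
    apply (ex_series_minus (V := R_NormedModule)); now apply Hs. }
split; [assumption|].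
apply is_derive_quadratic_bound with (r := Rmin (x - a) (b - x)) (K := Series M).
- apply Rmin_pos; lra.
- intros y Hy.
  assert (Hyab : a < y < b).
  { pose proof (Rmin_l (x - a) (b - x)); pose proof (Rmin_r (x - a) (b - x)).
    apply Rabs_def2 in Hy; lra. }
  rewrite <- Series_scal_l, <- !Series_minus; auto.
  2: now apply (ex_series_minus (V := R_NormedModule)); apply Hs.
  2: now apply (ex_series_scal_l (V := R_NormedModule)).
  change (Rabs (Series (rem y)) <= Series M * (y - x) ^ 2).
  rewrite <- Series_scal_r.
  apply Rle_trans with (Series (fun n => Rabs (rem y n))).
  + apply Series_Rabs, (ex_series_le (V := R_CompleteNormedModule)) with (2 := HsMy y).
    intros n; unfold norm; simpl; unfold abs; simpl; rewrite Rabs_Rabsolu; now apply Hrem.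
  + apply Series_le; [|apply HsMy].
    intros n; split; [apply Rabs_pos | now apply Hrem].
Qed.

Lemma is_series_inv_telescope : is_series (fun n => / ((INR n + 1) * (INR n + 2))) 1.
Proof.
change (is_lim_seq (sum_n (fun n => / ((INR n + 1) * (INR n + 2)))) 1).
apply (is_lim_seq_ext (fun n => 1 - / (INR n + 2))).
- intros n; induction n as [|n IH].
  + rewrite sum_O; simpl; field.
  + rewrite sum_Sn, <- IH, S_INR; unfold plus; simpl.
    pose proof (pos_INR n); field; lra.
- replace (Finite 1) with (Finite (1 - 0)) by (f_equal; ring).
  apply is_lim_seq_minus'; [apply is_lim_seq_const|].
  apply (is_lim_seq_inv _ p_infty); [|discriminate].
  apply (is_lim_seq_plus _ _ p_infty 2); [apply is_lim_seq_INR | apply is_lim_seq_const|].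
  reflexivity.
Qed.

(** Comparison with the telescoping series, through
    [n + 1 <= (1 + / a) (a + n)]. *)
Lemma ex_series_inv_pow (m : nat) (a : R) : (2 <= m)%nat -> 0 < a ->
  ex_series (fun n => / (a + INR n) ^ m).
Proof.
intros Hm Ha; replace m with (m - 2 + 2)%nat by lia.
set (p := (m - 2)%nat).
set (C := / a ^ p * (2 * (1 + / a) ^ 2)).
apply (ex_series_le (V := R_CompleteNormedModule))
  with (b := fun n => C * / ((INR n + 1) * (INR n + 2))).
2: apply (ex_series_scal_l (V := R_NormedModule)); eexists; apply is_series_inv_telescope.
intros n; pose proof (pos_INR n) as Hn.
unfold norm; simpl; unfold abs; simpl.
assert (0 < (a + INR n) ^ p) by (apply pow_lt; lra).
assert (0 < (a + INR n) ^ (p + 2)) by (apply pow_lt; lra).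
rewrite Rabs_pos_eq by (left; now apply Rinv_0_lt_compat).
rewrite pow_add, Rinv_mult; unfold C.
replace (/ a ^ p * (2 * (1 + / a) ^ 2) * / ((INR n + 1) * (INR n + 2)))
  with (/ a ^ p * (2 * (1 + / a) ^ 2 * / ((INR n + 1) * (INR n + 2)))) by ring.
apply Rmult_le_compat.
- left; now apply Rinv_0_lt_compat.
- left; apply Rinv_0_lt_compat, pow_lt; lra.
- apply Rinv_le_contravar; [now apply pow_lt|]. apply pow_incr; lra.
- assert (Hp : 0 < (a + INR n) ^ 2) by (apply pow_lt; lra).
  assert (H1 : INR n + 1 <= (1 + / a) * (a + INR n)).
  { replace ((1 + / a) * (a + INR n)) with (a + INR n + 1 + INR n * / a) by (field; lra).
    assert (0 <= INR n * / a) by (apply Rmult_le_pos; [|left; apply Rinv_0_lt_compat]; lra).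
    lra. }
  apply (Rmult_le_reg_r ((a + INR n) ^ 2 * ((INR n + 1) * (INR n + 2)))).
  { apply Rmult_lt_0_compat; [assumption|apply Rmult_lt_0_compat; lra]. }
  replace (/ (a + INR n) ^ 2 * ((a + INR n) ^ 2 * ((INR n + 1) * (INR n + 2))))
    with ((INR n + 1) * (INR n + 2)) by (field; lra).
  replace (2 * (1 + / a) ^ 2 * / ((INR n + 1) * (INR n + 2)) *
    ((a + INR n) ^ 2 * ((INR n + 1) * (INR n + 2))))
    with (2 * (((1 + / a) * (a + INR n)) * ((1 + / a) * (a + INR n)))) by (field; lra).
  apply Rle_trans with (2 * ((INR n + 1) * (INR n + 1))).
  + nra.
  + apply Rmult_le_compat_l; [lra|]; apply Rmult_le_compat; lra.
Qed.

Definition hurwitz (m : nat) (x : R) : R := Series (fun n => / (x + INR n) ^ m).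

(** Moving [x] to the right of [0] changes finitely many terms. *)
Lemma ex_series_hurwitz (m : nat) (x : R) : (2 <= m)%nat ->
  ex_series (fun n => / (x + INR n) ^ m).
Proof.
intros Hm; destruct (nfloor_ex (Rabs x) (Rabs_pos x)) as [N HN].
apply (ex_series_incr_n (V := R_NormedModule) _ (S N)).
apply ex_series_ext with (fun n => / (x + INR (S N) + INR n) ^ m).
- intros n; rewrite plus_INR; f_equal; f_equal; ring.
- apply ex_series_inv_pow; [assumption|]; rewrite S_INR.
  pose proof (Rle_abs (- x)); rewrite Rabs_Ropp in *; lra.
Qed.

Lemma hurwitz_succ (m : nat) (x : R) : (2 <= m)%nat ->
  hurwitz m x = / x ^ m + hurwitz m (x + 1).
Proof.
intros Hm; unfold hurwitz; rewrite Series_incr_1 by now apply ex_series_hurwitz.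
f_equal; [f_equal; f_equal; simpl; ring|].
apply Series_ext; intros n; rewrite S_INR; f_equal; f_equal; ring.
Qed.

Lemma is_derive_inv_pow (m : nat) (c t : R) : t + c <> 0 ->
  is_derive (fun t => / (t + c) ^ m) t (- INR m * / (t + c) ^ S m).
Proof.
intros H; assert ((t + c) ^ m <> 0) by now apply pow_nonzero.
destruct m as [|m].
- apply is_derive_ext with (fun _ => 1); [intros; simpl; now rewrite Rinv_1|].
  replace (- INR 0 * _) with 0 by (simpl; ring).
  apply (is_derive_const (V := R_NormedModule)).
- auto_derive; [assumption|].
  rewrite <- !Rdiv_def; change (pred (S m)) with m.
  change (match m with O => 1 | S _ => INR m + 1 end) with (INR (S m)).
  assert ((t + c) ^ m <> 0) by now apply pow_nonzero.
  simpl ((t + c) ^ _); field; auto.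
Qed.

Lemma inv_pow_le (m n : nat) (a t : R) : 0 < a -> a <= t ->
  Rabs (/ (t + INR n) ^ m) <= / (a + INR n) ^ m.
Proof.
intros Ha Ht; pose proof (pos_INR n).
assert (0 < (a + INR n) ^ m) by (apply pow_lt; lra).
assert (0 < (t + INR n) ^ m) by (apply pow_lt; lra).
rewrite Rabs_pos_eq by (left; now apply Rinv_0_lt_compat).
apply Rinv_le_contravar; [assumption | apply pow_incr; lra].
Qed.

Lemma is_derive_hurwitz_pos (m : nat) (x : R) : (2 <= m)%nat -> 0 < x ->
  is_derive (hurwitz m) x (- INR m * hurwitz (S m) x).
Proof.
intros Hm Hx; unfold hurwitz at 2; rewrite <- Series_scal_l.
apply (Series_derive (fun n t => / (t + INR n) ^ m)
  (fun n t => - INR m * / (t + INR n) ^ S m)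
  (fun n t => - INR m * (- INR (S m) * / (t + INR n) ^ S (S m)))
  (x / 2) (x + 1) (fun n => INR m * INR (S m) * / (x / 2 + INR n) ^ S (S m))).
- intros n t Ht; apply is_derive_inv_pow; pose proof (pos_INR n); lra.
- intros n t Ht; apply (is_derive_scal (fun t => / (t + INR n) ^ S m)).
  apply is_derive_inv_pow; pose proof (pos_INR n); lra.
- intros n t Ht.
  pose proof (pos_INR m); pose proof (pos_INR (S m)).
  rewrite <- Rmult_assoc, Rabs_mult.
  rewrite (Rabs_pos_eq (- INR m * - INR (S m))) by nra.
  replace (- INR m * - INR (S m)) with (INR m * INR (S m)) by ring.
  apply Rmult_le_compat_l; [nra|apply inv_pow_le; lra].
- apply (ex_series_scal_l (V := R_NormedModule)), ex_series_inv_pow; [lia|lra].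
- intros; now apply ex_series_hurwitz.
- lra.
Qed.

(** The complement of the poles of the Gamma function. *)
Definition regular (x : R) : Prop := forall n : nat, x + INR n <> 0.

(** The way to extend statements from the positive half-line to all regular points by
    a functional equation relating [x] and [x + 1]. *)
Lemma regular_ind (P : R -> Prop) :
  (forall x, 0 < x -> P x) -> (forall x, x <> 0 -> P (x + 1) -> P x) ->
  forall x, regular x -> P x.
Proof.
intros Hpos Hstep.
assert (H : forall n x, - INR n < x -> regular x -> P x).
{ induction n as [|n IH]; intros x Hx Hr.
  - apply Hpos; simpl in Hx; lra.
  - apply Hstep.
    + specialize (Hr O); simpl in Hr; lra.
    + apply IH; [rewrite S_INR in Hx; lra|].
      intros k; specialize (Hr (S k)); rewrite S_INR in Hr; lra. }
intros x Hx; destruct (nfloor_ex (Rabs x) (Rabs_pos x)) as [N HN].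
apply (H (S N)); [|assumption]; rewrite S_INR.
pose proof (Rle_abs (- x)); rewrite Rabs_Ropp in *; lra.
Qed.

Lemma locally_shift (P : R -> Prop) (x c : R) :
  locally (x + c) P -> locally x (fun y => P (y + c)).
Proof.
intros H; apply (continuous_plus (fun y : R => y) (fun _ => c) x) in H; auto.
- apply continuous_id.
- apply continuous_const.
Qed.

Lemma locally_pos (x : R) : 0 < x -> locally x (fun y => 0 < y).
Proof. apply (open_gt 0). Qed.

Lemma regular_locally (x : R) : regular x -> locally x regular.
Proof.
revert x; apply regular_ind.
- intros x Hx; apply filter_imp with (2 := locally_pos x Hx).
  intros y Hy n; pose proof (pos_INR n); lra.
- intros x Hx H; apply locally_shift in H.
  apply filter_imp with (2 := filter_and _ _ H (open_neq 0 x Hx)).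
  intros y [Hy Hy0] [|n].
  + simpl; lra.
  + specialize (Hy n); rewrite S_INR; lra.
Qed.

Lemma is_derive_shift (f : R -> R) (x c l : R) :
  is_derive f (x + c) l -> is_derive (fun y => f (y + c)) x l.
Proof.
intros H; replace l with (scal 1 l) by apply (scal_one (V := R_NormedModule)).
apply (is_derive_comp f (fun y => y + c)); [assumption|].
auto_derive; [auto | ring].
Qed.

Lemma is_derive_hurwitz (m : nat) (x : R) : (2 <= m)%nat -> regular x ->
  is_derive (hurwitz m) x (- INR m * hurwitz (S m) x).
Proof.
intros Hm; revert x; apply regular_ind; [intros; now apply is_derive_hurwitz_pos|].
intros x Hx H; rewrite hurwitz_succ by lia.
apply is_derive_ext with (fun y => / y ^ m + hurwitz m (y + 1)).
{ intros; symmetry; now apply hurwitz_succ. }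
rewrite Rmult_plus_distr_l.
apply (is_derive_plus (fun y => / y ^ m)); [|now apply is_derive_shift].
apply is_derive_ext with (fun t => / (t + 0) ^ m); [intros; now rewrite Rplus_0_r|].
rewrite <- (Rplus_0_r x) at 2; apply is_derive_inv_pow; lra.
Qed.

(** * Gauss's formula and the polygamma functions *)

(** The logarithm of [Gamma (x + n) / (n! (n + 1)^(x - 1))], whose convergence to [0] is
    Gauss's formula. *)
Definition gauss_defect (x : R) (n : nat) : R :=
  ln (Gamma_integral (x + INR n)) - ln (Gamma_integral (INR n + 1))
  - (x - 1) * ln (INR n + 1).

Lemma ln_Gamma_integral_succ (x : R) : 0 < x ->
  ln (Gamma_integral (x + 1)) = ln x + ln (Gamma_integral x).
Proof.
intros Hx; rewrite Gamma_integral_succ by assumption.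
apply ln_mult; [assumption | now apply Gamma_integral_pos].
Qed.

(** Wendel's inequality from [N] to [N + x] gives the upper bound, from [N + x] to
    [N + 1] the lower one. *)
Lemma gauss_defect_bounds (x : R) (n : nat) : 0 < x <= 1 ->
  0 <= gauss_defect x (S n) <= / (INR n + 1).
Proof.
intros Hx; unfold gauss_defect; set (N := INR (S n)).
assert (HN : 0 < N) by (apply lt_0_INR; lia).
rewrite ln_Gamma_integral_succ by assumption.
assert (Hw : forall y s, 0 < y -> 0 <= s <= 1 ->
  ln (Gamma_integral (y + s)) <= s * ln y + ln (Gamma_integral y)).
{ intros y s Hy Hs.
  rewrite <- ln_Rpower, <- ln_mult by (try apply exp_pos; now apply Gamma_integral_pos).
  apply ln_le; [apply Gamma_integral_pos; lra | now apply Gamma_integral_wendel]. }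
pose proof (Hw N x HN ltac:(lra)) as H1.
pose proof (Hw (x + N) (1 - x) ltac:(lra) ltac:(lra)) as H2.
replace (x + N + (1 - x)) with (N + 1) in H2 by ring.
rewrite ln_Gamma_integral_succ in H2 by assumption.
rewrite (Rplus_comm N x) in H1.
assert (H3 : ln (x + N) <= ln (N + 1)) by (apply ln_le; lra).
assert (H4 : 0 <= ln (N + 1) - ln N <= / (INR n + 1)).
{ split; [assert (ln N <= ln (N + 1)) by (apply ln_le; lra); lra|].
  rewrite <- ln_div by lra; replace ((N + 1) / N) with (1 + / N) by (field; lra).
  rewrite <- S_INR; fold N.
  pose proof (Rinv_0_lt_compat N HN).
  pose proof (ln_le_sub_1 (1 + / N)); lra. }
split.
- apply (Rmult_le_compat_l (1 - x)) in H3; lra.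
- assert ((1 - x) * (ln (N + 1) - ln N) <= 1 * / (INR n + 1)) by
    (apply Rmult_le_compat; lra).
  lra.
Qed.

Lemma is_lim_seq_inv_succ (c : R) : is_lim_seq (fun n => c * / (INR n + 1)) 0.
Proof.
replace (Finite 0) with (Finite (c * 0)) by (f_equal; ring).
apply (is_lim_seq_scal_l _ c 0).
apply (is_lim_seq_ext (fun n => / INR (S n))).
{ intros n; now rewrite S_INR. }
apply (is_lim_seq_incr_1 (fun n => / INR n)).
apply (is_lim_seq_inv _ p_infty); [apply is_lim_seq_INR | discriminate].
Qed.

(** Wendel's inequality covers [(0, 1]]; the functional equation changes the defect by
    [ln ((x + n) / (n + 1))] when [x] grows by [1]. *)
Lemma gauss_defect_lim (x : R) : 0 < x -> is_lim_seq (gauss_defect x) 0.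
Proof.
assert (H : forall k x, 0 < x <= INR k + 1 -> is_lim_seq (gauss_defect x) 0).
{ clear x; induction k as [|k IH]; intros x Hx.
  - simpl in Hx; apply is_lim_seq_incr_1.
    apply (is_lim_seq_le_le (fun _ => 0) _ (fun n => 1 * / (INR n + 1))).
    + intros n; rewrite Rmult_1_l; apply gauss_defect_bounds; lra.
    + apply is_lim_seq_const.
    + apply is_lim_seq_inv_succ.
  - rewrite S_INR in Hx; destruct (Rle_lt_dec x 1) as [H1|H1].
    { apply IH; pose proof (pos_INR k); lra. }
    apply (is_lim_seq_ext (fun n => gauss_defect (x - 1) n
      + ln (1 + (x - 2) * / (INR n + 1)))).
    + intros n; unfold gauss_defect; pose proof (pos_INR n).
      replace (x + INR n) with (x - 1 + INR n + 1) by ring.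
      rewrite (ln_Gamma_integral_succ (x - 1 + INR n)) by lra.
      replace (1 + (x - 2) * / (INR n + 1)) with ((x - 1 + INR n) / (INR n + 1))
        by (field; lra).
      rewrite ln_div by lra; ring.
    + replace (Finite 0) with (Finite (0 + ln (1 + 0)))
        by (f_equal; rewrite Rplus_0_r, ln_1; ring).
      apply is_lim_seq_plus'; [apply IH; lra|].
      apply (is_lim_seq_continuous ln).
      { rewrite Rplus_0_r; apply continuity_pt_filterlim, continuous_ln; lra. }
      apply is_lim_seq_plus'; [apply is_lim_seq_const | apply is_lim_seq_inv_succ]. }
intros Hx; destruct (nfloor_ex x ltac:(lra)) as [n Hn]; apply (H n); lra.
Qed.

(** Equal to [gauss_defect x n - gauss_defect x (n + 1)], so that the partial sums
    telescope. *)
Definition ln_Gamma_term (n : nat) (x : R) : R :=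
  ln (INR n + 1) + (x - 1) * (ln (INR n + 2) - ln (INR n + 1)) - ln (x + INR n).

Lemma is_series_ln_Gamma (x : R) : 0 < x ->
  is_series (fun n => ln_Gamma_term n x) (ln (Gamma_integral x)).
Proof.
intros Hx.
change (is_lim_seq (sum_n (fun n => ln_Gamma_term n x)) (ln (Gamma_integral x))).
assert (Hstep : forall n,
  gauss_defect x n - gauss_defect x (S n) = ln_Gamma_term n x).
{ intros n; unfold gauss_defect, ln_Gamma_term; pose proof (pos_INR n).
  rewrite S_INR.
  replace (x + (INR n + 1)) with (x + INR n + 1) by ring.
  rewrite (ln_Gamma_integral_succ (x + INR n)), (ln_Gamma_integral_succ (INR n + 1)) by lra.
  replace (INR n + 1 + 1) with (INR n + 2) by ring; ring. }
apply (is_lim_seq_ext (fun n => ln (Gamma_integral x) - gauss_defect x (S n))).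
- induction n as [|n IH].
  + rewrite sum_O, <- Hstep; unfold gauss_defect at 2; simpl (INR 0).
    rewrite Rplus_0_r, Rplus_0_l, Gamma_integral_1, ln_1; ring.
  + rewrite sum_Sn, <- IH, <- Hstep; unfold plus; simpl; ring.
- replace (Finite (ln (Gamma_integral x))) with (Finite (ln (Gamma_integral x) - 0))
    by (f_equal; ring).
  apply is_lim_seq_minus'; [apply is_lim_seq_const|].
  apply -> is_lim_seq_incr_1; now apply gauss_defect_lim.
Qed.

Definition digamma_series (x : R) : R :=
  Series (fun n => ln (INR n + 2) - ln (INR n + 1) - / (x + INR n)).

Lemma ex_derive_ln_Gamma (x : R) : 0 < x ->
  ex_series (fun n => ln (INR n + 2) - ln (INR n + 1) - / (x + INR n)) /\
  is_derive (fun y => ln (Gamma_integral y)) x (digamma_series x).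
Proof.
intros Hx.
destruct (Series_derive ln_Gamma_term
  (fun n t => ln (INR n + 2) - ln (INR n + 1) - / (t + INR n))
  (fun n t => / (t + INR n) ^ 2) (x / 2) (x + 1)
  (fun n => / (x / 2 + INR n) ^ 2)) with (x := x) as [H1 H2].
- intros n t Ht; pose proof (pos_INR n); unfold ln_Gamma_term.
  auto_derive; [lra | field; lra].
- intros n t Ht; pose proof (pos_INR n).
  auto_derive; [lra | field; lra].
- intros n t Ht; apply inv_pow_le; lra.
- apply ex_series_inv_pow; [lia | lra].
- intros t Ht; eexists; apply is_series_ln_Gamma; lra.
- lra.
- split; [exact H1|].
  apply (is_derive_ext_loc _ _ _ _) with (2 := H2).
  apply filter_imp with (2 := locally_pos x Hx).
  intros y Hy; now apply is_series_unique, is_series_ln_Gamma.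
Qed.

Lemma is_derive_digamma_series (x : R) : 0 < x ->
  is_derive digamma_series x (hurwitz 2 x).
Proof.
intros Hx; unfold digamma_series, hurwitz.
apply (Series_derive (fun n t => ln (INR n + 2) - ln (INR n + 1) - / (t + INR n))
  (fun n t => / (t + INR n) ^ 2) (fun n t => - INR 2 * / (t + INR n) ^ 3)
  (x / 2) (x + 1) (fun n => INR 2 * / (x / 2 + INR n) ^ 3)).
- intros n t Ht; pose proof (pos_INR n).
  auto_derive; [lra | field; lra].
- intros n t Ht; apply is_derive_inv_pow; pose proof (pos_INR n); lra.
- intros n t Ht; rewrite Rabs_mult, Rabs_Ropp, Rabs_pos_eq by apply pos_INR.
  apply Rmult_le_compat_l; [apply pos_INR|apply inv_pow_le; lra].
- apply (ex_series_scal_l (V := R_NormedModule)), ex_series_inv_pow; [lia|lra].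
- intros t Ht; apply ex_derive_ln_Gamma; lra.
- lra.
Qed.

Lemma Gamma_shift_pos (x : R) : 0 < x -> Gamma_shift x = O.
Proof.
intros Hx; unfold Gamma_shift; destruct (archimed (- x)) as [_ H].
assert (up (- x) < 1)%Z by (apply lt_IZR; lra).
destruct (up (- x)) eqn:E; try reflexivity; lia.
Qed.

Lemma Gamma_pos_eq (x : R) : 0 < x -> Gamma x = Gamma_integral x.
Proof.
intros Hx; unfold Gamma; rewrite Gamma_shift_pos by assumption; simpl.
rewrite Rplus_0_r; field.
Qed.

Lemma rising_succ_l (x : R) (n : nat) : rising x (S n) = x * rising (x + 1) n.
Proof.
induction n as [|n IH]; [simpl; ring|].
change (rising x (S (S n))) with (rising x (S n) * (x + INR (S n))).
rewrite IH, S_INR; simpl; ring.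
Qed.

Lemma Gamma_succ (x : R) : x <> 0 -> Gamma x = Gamma (x + 1) / x.
Proof.
intros Hx; destruct (Rlt_le_dec 0 x) as [H|H].
- rewrite !Gamma_pos_eq, Gamma_integral_succ by lra; field; lra.
- unfold Gamma.
  assert (E : Gamma_shift x = S (Gamma_shift (x + 1))).
  { unfold Gamma_shift; destruct (archimed (- x)) as [H1 H2].
    assert (E : up (- (x + 1)) = (up (- x) - 1)%Z).
    { symmetry; apply tech_up; rewrite minus_IZR; lra. }
    assert (0 < up (- x))%Z by (apply lt_IZR; lra).
    rewrite E; lia. }
  rewrite E, rising_succ_l, S_INR.
  replace (x + (INR (Gamma_shift (x + 1)) + 1)) with (x + 1 + INR (Gamma_shift (x + 1))) by ring.
  unfold Rdiv; rewrite Rinv_mult; ring.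
Qed.

(** Nonvanishing and differentiability of [Gamma] are carried along in a neighbourhood,
    because [digamma] has to be known near [x] before it can be differentiated. *)
Lemma Gamma_digamma_regular (x : R) : regular x ->
  locally x (fun y => Gamma y <> 0 /\ ex_derive Gamma y) /\
  is_derive digamma x (hurwitz 2 x).
Proof.
revert x; apply regular_ind; intros x Hx.
- assert (HG : forall y, 0 < y -> is_derive Gamma y (Gamma_integral y * digamma_series y)).
  { intros y Hy.
    apply (is_derive_ext_loc (fun t => exp (ln (Gamma_integral t)))).
    { apply filter_imp with (2 := locally_pos y Hy).
      intros t Ht; rewrite Gamma_pos_eq by assumption.
      now apply exp_ln, Gamma_integral_pos. }
    rewrite Rmult_comm.
    rewrite <- (exp_ln (Gamma_integral y)) at 1 by now apply Gamma_integral_pos.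
    apply (is_derive_comp exp (fun t => ln (Gamma_integral t)));
      [apply is_derive_exp | now apply ex_derive_ln_Gamma]. }
  split.
  + apply filter_imp with (2 := locally_pos x Hx); intros y Hy; split.
    * rewrite Gamma_pos_eq by assumption; apply Rgt_not_eq; now apply Gamma_integral_pos.
    * eexists; now apply HG.
  + apply (is_derive_ext_loc digamma_series); [|now apply is_derive_digamma_series].
    apply filter_imp with (2 := locally_pos x Hx); intros y Hy; unfold digamma.
    rewrite (is_derive_unique _ _ _ (HG y Hy)), Gamma_pos_eq by assumption.
    pose proof (Gamma_integral_pos y Hy); eq_in_R; field; lra.
- intros [H1 H2].
  assert (HG : locally x (fun y => y <> 0 /\ Gamma (y + 1) <> 0 /\ ex_derive Gamma (y + 1))).
  { apply filter_and; [now apply open_neq|].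
    apply (locally_shift (fun y => Gamma y <> 0 /\ ex_derive Gamma y)), H1. }
  assert (HD : forall y, y <> 0 -> Gamma (y + 1) <> 0 -> ex_derive Gamma (y + 1) ->
    is_derive Gamma y ((digamma (y + 1) - / y) * Gamma y)).
  { intros y Hy HG0 HG1.
    apply (is_derive_ext_loc (fun t => Gamma (t + 1) / t)).
    { apply filter_imp with (2 := open_neq 0 y Hy).
      intros t Ht; symmetry; now apply Gamma_succ. }
    rewrite (Gamma_succ y Hy); unfold digamma.
    auto_derive; [auto|].
    change (fun x => Gamma x) with Gamma; eq_in_R; field; auto. }
  split.
  + apply filter_imp with (2 := HG); intros y (Hy & HG0 & HG1); split.
    * rewrite Gamma_succ by assumption; unfold Rdiv.
      apply Rmult_integral_contrapositive; split; [assumption | now apply Rinv_neq_0_compat].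
    * eexists; now apply HD.
  + apply (is_derive_ext_loc (fun y => digamma (y + 1) - / y)).
    { apply filter_imp with (2 := HG); intros y (Hy & HG0 & HG1); unfold digamma at 2.
      rewrite (is_derive_unique _ _ _ (HD y Hy HG0 HG1)); eq_in_R; field.
      split; [assumption|]; rewrite Gamma_succ by assumption; unfold Rdiv.
      apply Rmult_integral_contrapositive; split; [assumption | now apply Rinv_neq_0_compat]. }
    rewrite hurwitz_succ by lia.
    replace (/ x ^ 2 + hurwitz 2 (x + 1)) with (hurwitz 2 (x + 1) - (- / x ^ 2)) by ring.
    apply (is_derive_minus (fun y => digamma (y + 1))); [now apply is_derive_shift|].
    auto_derive; [assumption | field; assumption].
Qed.

Lemma polygamma_hurwitz (k : nat) (x : R) : (1 <= k)%nat -> regular x ->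
  polygamma k x = (-1) ^ (k + 1) * INR (fact k) * hurwitz (k + 1) x.
Proof.
intros Hk; unfold polygamma; destruct k as [|k]; [lia|clear Hk].
revert x; induction k as [|k IH]; intros x Hx.
- change (Derive_n digamma 1 x) with (Derive digamma x).
  rewrite (is_derive_unique _ _ _ (proj2 (Gamma_digamma_regular x Hx))).
  simpl; ring.
- change (Derive_n digamma (S (S k)) x) with (Derive (Derive_n digamma (S k)) x).
  rewrite (Derive_ext_loc _ (fun y => (-1) ^ (S k + 1) * INR (fact (S k)) * hurwitz (S k + 1) y)).
  + rewrite Derive_scal, (is_derive_unique _ _ _ (is_derive_hurwitz (S k + 1) x ltac:(lia) Hx)).
    replace (S (S k) + 1)%nat with (S (S k + 1)) by lia.
    replace (fact (S (S k))) with ((S k + 1) * fact (S k))%nat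
      by (now rewrite Nat.add_1_r).
    rewrite mult_INR; rewrite <- (tech_pow_Rmult (-1) (S k + 1)); ring.
  + apply filter_imp with (2 := regular_locally x Hx); exact IH.
Qed.

(** * The bilateral sum and the cosecant *)

(** The sum of [1 / (x + n)^m] over all integers [n]: the terms with [n < 0] are
    [(-1)^m / (1 - x + j)^m], where [j = - n - 1]. *)
Definition bilateral (m : nat) (x : R) : R :=
  hurwitz m x + (-1) ^ m * hurwitz m (1 - x).

Lemma pow_opp_swap (m : nat) (x : R) : (-1) ^ m * / (- x) ^ m = / x ^ m.
Proof.
rewrite <- pow_inv, <- pow_inv, <- Rpow_mult_distr; f_equal.
rewrite Rinv_opp; ring.
Qed.

Lemma bilateral_succ (m : nat) (x : R) : (2 <= m)%nat ->
  bilateral m (x + 1) = bilateral m x.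
Proof.
intros Hm; unfold bilateral; rewrite (hurwitz_succ m x) by assumption.
replace (1 - (x + 1)) with (- x) by ring.
rewrite (hurwitz_succ m (- x)) by assumption.
replace (- x + 1) with (1 - x) by ring.
rewrite Rmult_plus_distr_l, pow_opp_swap; ring.
Qed.

Lemma bilateral_period (m : nat) (x : R) (z : Z) : (2 <= m)%nat ->
  bilateral m (x + IZR z) = bilateral m x.
Proof.
intros Hm.
assert (H : forall n y, bilateral m (y + INR n) = bilateral m y).
{ induction n as [|n IH]; intros y; [simpl; now rewrite Rplus_0_r|].
  rewrite S_INR, <- Rplus_assoc, bilateral_succ; auto. }
destruct (Z.lt_ge_cases z 0) as [Hz|Hz].
- rewrite <- (H (Z.to_nat (- z)) (x + IZR z)), INR_IZR_INZ, Z2Nat.id by lia.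
  f_equal; rewrite opp_IZR; ring.
- rewrite <- (H (Z.to_nat z) x), INR_IZR_INZ, Z2Nat.id by lia; reflexivity.
Qed.

Lemma is_derive_bilateral (m : nat) (x : R) : (2 <= m)%nat -> 0 < x < 1 ->
  is_derive (bilateral m) x (- INR m * bilateral (S m) x).
Proof.
intros Hm Hx; unfold bilateral.
replace (- INR m * (hurwitz (S m) x + (-1) ^ S m * hurwitz (S m) (1 - x)))
  with (- INR m * hurwitz (S m) x
        + (-1) ^ m * (- 1 * (- INR m * hurwitz (S m) (1 - x)))) by (simpl; ring).
apply (is_derive_plus (hurwitz m)); [apply is_derive_hurwitz_pos; lra || lia|].
apply (is_derive_scal (fun y => hurwitz m (1 - y))).
apply (is_derive_comp (hurwitz m) (fun y => 1 - y)).
- apply is_derive_hurwitz_pos; lra || lia.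
- auto_derive; [auto | ring].
Qed.

Lemma inv_pow_pos (m n : nat) (x : R) : 0 < x -> 0 < / (x + INR n) ^ m.
Proof.
intros Hx; pose proof (pos_INR n); apply Rinv_0_lt_compat, pow_lt; lra.
Qed.

Lemma hurwitz_decr (m : nat) (x y : R) : (2 <= m)%nat -> 0 < x -> x <= y ->
  hurwitz m y <= hurwitz m x.
Proof.
intros Hm Hx Hy; apply Series_le; [|now apply ex_series_hurwitz].
intros n; pose proof (inv_pow_pos m n y ltac:(lra)); split; [lra|].
apply Rle_trans with (1 := Rle_abs _); now apply inv_pow_le.
Qed.

Lemma hurwitz_nonneg (m : nat) (x : R) : (2 <= m)%nat -> 0 < x -> 0 <= hurwitz m x.
Proof.
intros Hm Hx; replace 0 with (Series (fun _ => 0 * 0)) by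
  (rewrite Series_scal_l; ring).
apply Series_le; [|now apply ex_series_hurwitz].
intros n; rewrite Rmult_0_l; split; [lra | left; now apply inv_pow_pos].
Qed.

Lemma hurwitz_gt_0 (m : nat) (x : R) : (2 <= m)%nat -> 0 < x -> 0 < hurwitz m x.
Proof.
intros Hm Hx; rewrite hurwitz_succ by assumption.
pose proof (hurwitz_nonneg m (x + 1) Hm ltac:(lra)).
pose proof (inv_pow_pos m 0 x Hx) as H0; simpl INR in H0; rewrite Rplus_0_r in H0; lra.
Qed.

Lemma hurwitz_strict_decr (m : nat) (x y : R) : (2 <= m)%nat -> 0 < x -> x < y ->
  hurwitz m y < hurwitz m x.
Proof.
intros Hm Hx Hy; rewrite (hurwitz_succ m x), (hurwitz_succ m y) by assumption.
pose proof (hurwitz_decr m (x + 1) (y + 1) Hm ltac:(lra) ltac:(lra)).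
assert (/ y ^ m < / x ^ m); [|lra].
apply Rinv_lt_contravar.
- apply Rmult_lt_0_compat; apply pow_lt; lra.
- destruct m as [|m]; [lia|].
  simpl; apply Rmult_gt_0_lt_compat.
  + apply pow_lt; lra.
  + lra.
  + lra.
  + destruct m as [|m]; [lia|].
    apply Rle_lt_trans with (x * y ^ m).
    * simpl; apply Rmult_le_compat_l; [lra|apply pow_incr; lra].
    * simpl; apply Rmult_lt_compat_r; [apply pow_lt|]; lra.
Qed.

Lemma bilateral_eq_0 (m : nat) (x : R) : (2 <= m)%nat -> 0 < x < 1 ->
  bilateral m x = 0 <-> x = 1 / 2 /\ Nat.Odd m.
Proof.
intros Hm Hx; unfold bilateral.
destruct (Nat.Even_or_Odd m) as [He|Ho].
- split; [|intros [_ Ho]; destruct (Nat.Even_Odd_False m He Ho)].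
  destruct He as [p ->]; rewrite pow_1_even.
  pose proof (hurwitz_gt_0 (2 * p) x Hm ltac:(lra)).
  pose proof (hurwitz_gt_0 (2 * p) (1 - x) Hm ltac:(lra)); lra.
- assert (E : (-1) ^ m = -1).
  { destruct Ho as [p ->]; rewrite Nat.add_1_r; apply pow_1_odd. }
  rewrite E; split.
  + intros H; split; [|assumption].
    destruct (Rtotal_order x (1 - x)) as [Hl|[Hl|Hl]]; [|lra|].
    * pose proof (hurwitz_strict_decr m x (1 - x) Hm ltac:(lra) Hl); lra.
    * pose proof (hurwitz_strict_decr m (1 - x) x Hm ltac:(lra) Hl); lra.
  + intros [-> _]; replace (1 - 1 / 2) with (1 / 2) by field; ring.
Qed.

Lemma Series_pairs (a : nat -> R) : ex_series a ->
  Series a = Series (fun n => a (2 * n)%nat + a (2 * n + 1)%nat).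
Proof.
intros [l Hl]; rewrite (is_series_unique _ _ Hl).
symmetry; apply is_series_unique.
change (is_lim_seq (sum_n (fun n => a (2 * n)%nat + a (2 * n + 1)%nat)) l).
apply (is_lim_seq_ext (fun n => sum_n a (2 * n + 1))).
- induction n as [|n IH].
  + change (2 * 0 + 1)%nat with 1%nat; rewrite sum_Sn, !sum_O; reflexivity.
  + rewrite sum_Sn, <- IH.
    replace (2 * S n + 1)%nat with (S (S (2 * n + 1))) by lia.
    replace (2 * S n)%nat with (S (2 * n + 1)) by lia.
    rewrite !sum_Sn; unfold plus; simpl; ring.
- apply (is_lim_seq_subseq (sum_n a) l (fun n => (2 * n + 1)%nat)); [|exact Hl].
  apply eventually_subseq; intros n; lia.
Qed.

(** Even and odd [n] in [1 / (x + n)^2] give the two series on the left. *)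
Lemma hurwitz_duplication (x : R) : 0 < x ->
  hurwitz 2 (x / 2) + hurwitz 2 ((x + 1) / 2) = 4 * hurwitz 2 x.
Proof.
intros Hx; unfold hurwitz.
rewrite (Series_pairs (fun n => / (x + INR n) ^ 2)) by (apply ex_series_hurwitz; lia).
rewrite <- Series_scal_l, <- Series_plus by (apply ex_series_hurwitz; lia).
apply Series_ext; intros n; rewrite plus_INR, !mult_INR; pose proof (pos_INR n).
simpl (INR 2); simpl (INR 1); field; lra.
Qed.

Lemma bilateral_duplication (x : R) : 0 < x < 1 ->
  bilateral 2 (x / 2) + bilateral 2 ((x + 1) / 2) = 4 * bilateral 2 x.
Proof.
intros Hx; unfold bilateral.
replace (1 - x / 2) with ((1 - x + 1) / 2) by field.
replace (1 - (x + 1) / 2) with ((1 - x) / 2) by field.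
pose proof (hurwitz_duplication x ltac:(lra)).
pose proof (hurwitz_duplication (1 - x) ltac:(lra)); lra.
Qed.

(** Write the difference as [(y - sin y) (y + sin y) / (y^2 sin^2 y)] and use
    [y - y^3 / 6 <= sin y], hence also [y / 3 <= sin y]. *)
Lemma inv_sin_sqr_bound (y : R) : 0 < y <= PI / 2 ->
  0 <= / sin y ^ 2 - / y ^ 2 <= 3.
Proof.
intros Hy; pose proof PI_4.
assert (Hs : sin y < y) by (apply sin_lt_x; lra).
assert (Hl : y - y ^ 3 / 6 <= sin y).
{ destruct (pre_sin_bound y 0) as [Hb _]; try lra.
  unfold sin_approx, sin_term in Hb; simpl in Hb.
  eapply Rle_trans; [|exact Hb]; right; field. }
assert (Hy3 : y / 3 <= sin y).
{ apply Rle_trans with (2 := Hl); assert (y ^ 2 <= 4) by nra.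
  replace (y - y ^ 3 / 6) with (y * (1 - y ^ 2 / 6)) by field.
  replace (y / 3) with (y * (1 / 3)) by field.
  apply Rmult_le_compat_l; lra. }
assert (Hp : 0 < y ^ 2 * sin y ^ 2) by (apply Rmult_lt_0_compat; apply pow_lt; lra).
replace (/ sin y ^ 2 - / y ^ 2) with ((y - sin y) * (y + sin y) / (y ^ 2 * sin y ^ 2))
  by (field; lra).
split.
- apply Rmult_le_pos; [|left; now apply Rinv_0_lt_compat].
  apply Rmult_le_pos; lra.
- apply (Rmult_le_reg_r (y ^ 2 * sin y ^ 2)); [assumption|].
  unfold Rdiv; rewrite Rmult_assoc, Rinv_l, Rmult_1_r by lra.
  apply Rle_trans with (y ^ 3 / 6 * (2 * y)).
  + apply Rmult_le_compat; lra.
  + apply Rle_trans with (3 * (y ^ 2 * (y / 3) ^ 2)); [right; field|].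
    apply Rmult_le_compat_l; [lra|]; apply Rmult_le_compat_l; [apply pow2_ge_0|].
    apply pow_incr; lra.
Qed.

Lemma sin_PI_pos (x : R) : 0 < x < 1 -> 0 < sin (PI * x).
Proof.
intros Hx; pose proof PI_RGT_0; apply sin_gt_0; nra.
Qed.

Definition herglotz_diff (x : R) : R := (PI / sin (PI * x)) ^ 2 - bilateral 2 x.

Lemma herglotz_diff_sym (x : R) : herglotz_diff (1 - x) = herglotz_diff x.
Proof.
unfold herglotz_diff, bilateral.
replace (PI * (1 - x)) with (PI - PI * x) by ring; rewrite sin_PI_x.
replace (1 - (1 - x)) with x by ring; ring.
Qed.

(** The poles at [0] and [1] cancel. By symmetry only [0 < x <= 1/2] matters, where
    [1 / (1 - x)^2] is harmless. *)
Lemma herglotz_diff_bounded : exists M, forall x, 0 < x < 1 -> Rabs (herglotz_diff x) <= M.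
Proof.
pose proof PI_RGT_0 as HPI.
exists (3 * PI ^ 2 + 4 + 2 * hurwitz 2 1).
assert (H : forall x, 0 < x <= 1 / 2 ->
  Rabs (herglotz_diff x) <= 3 * PI ^ 2 + 4 + 2 * hurwitz 2 1).
{ intros x Hx; pose proof (sin_PI_pos x ltac:(lra)) as Hs.
  unfold herglotz_diff, bilateral.
  rewrite (hurwitz_succ 2 x), (hurwitz_succ 2 (1 - x)) by lia.
  pose proof (hurwitz_nonneg 2 (x + 1) ltac:(lia) ltac:(lra)).
  pose proof (hurwitz_nonneg 2 (1 - x + 1) ltac:(lia) ltac:(lra)).
  pose proof (hurwitz_decr 2 1 (x + 1) ltac:(lia) ltac:(lra) ltac:(lra)).
  pose proof (hurwitz_decr 2 1 (1 - x + 1) ltac:(lia) ltac:(lra) ltac:(lra)).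
  pose proof (inv_sin_sqr_bound (PI * x) ltac:(nra)) as Hb.
  assert (E : (PI / sin (PI * x)) ^ 2 - / x ^ 2
    = PI ^ 2 * (/ sin (PI * x) ^ 2 - / (PI * x) ^ 2)) by (field; lra).
  set (d := / sin (PI * x) ^ 2 - / (PI * x) ^ 2) in *.
  assert (0 <= PI ^ 2 * d <= PI ^ 2 * 3).
  { pose proof (pow_lt PI 2 HPI); split.
    - apply Rmult_le_pos; lra.
    - apply Rmult_le_compat_l; lra. }
  assert (0 < / (1 - x) ^ 2 <= 4).
  { split; [apply Rinv_0_lt_compat, pow_lt; lra|].
    replace 4 with (/ (1 / 2) ^ 2) by field.
    apply Rinv_le_contravar; [apply pow_lt; lra | apply pow_incr; lra]. }
  replace ((-1) ^ 2) with 1 by ring.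
  apply Rabs_le; lra. }
intros x Hx; destruct (Rle_lt_dec x (1 / 2)) as [Hl|Hl].
- apply H; lra.
- rewrite <- herglotz_diff_sym; apply H; lra.
Qed.

Lemma herglotz_diff_duplication (x : R) : 0 < x < 1 ->
  herglotz_diff (x / 2) + herglotz_diff ((x + 1) / 2) = 4 * herglotz_diff x.
Proof.
intros Hx; unfold herglotz_diff.
pose proof (bilateral_duplication x Hx) as Hb.
pose proof (sin_PI_pos (x / 2) ltac:(lra)) as H1.
pose proof (sin_PI_pos ((x + 1) / 2) ltac:(lra)) as H2.
pose proof (sin_PI_pos x ltac:(lra)) as H3.
set (y := PI * (x / 2)) in *.
replace (PI * ((x + 1) / 2)) with (PI / 2 + y) in * by (unfold y; field).
replace (PI * x) with (2 * y) in * by (unfold y; field).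
rewrite sin_plus, sin_PI2, cos_PI2, Rmult_1_l, Rmult_0_l, Rplus_0_r in *.
rewrite sin_2a in *.
assert (E : (PI / sin y) ^ 2 + (PI / cos y) ^ 2
  = PI ^ 2 * ((sin y)² + (cos y)²) / (sin y ^ 2 * cos y ^ 2)).
{ unfold Rsqr; field; lra. }
rewrite sin2_cos2 in E.
assert (E2 : 4 * (PI / (2 * sin y * cos y)) ^ 2 = PI ^ 2 * 1 / (sin y ^ 2 * cos y ^ 2)).
{ field; lra. }
lra.
Qed.

(** Herglotz's trick: the duplication formula improves a bound [M] on the difference to
    [M / 2], hence to [M / 2^n] for all [n]. *)
Lemma bilateral_2_sin (x : R) : 0 < x < 1 -> bilateral 2 x = (PI / sin (PI * x)) ^ 2.
Proof.
intros Hx; destruct herglotz_diff_bounded as [M HM].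
assert (H : forall n y, 0 < y < 1 -> Rabs (herglotz_diff y) <= M * (1 / 2) ^ n).
{ induction n as [|n IH]; intros y Hy; [rewrite Rmult_1_r; now apply HM|].
  pose proof (IH (y / 2) ltac:(lra)) as H1.
  pose proof (IH ((y + 1) / 2) ltac:(lra)) as H2.
  pose proof (herglotz_diff_duplication y Hy) as H3.
  pose proof (Rabs_triang (herglotz_diff (y / 2)) (herglotz_diff ((y + 1) / 2))) as H4.
  rewrite H3, Rabs_mult, (Rabs_pos_eq 4) in H4 by lra.
  simpl; lra. }
assert (H0 : Rbar_le (Rabs (herglotz_diff x)) 0).
{ apply (is_lim_seq_le (fun _ => Rabs (herglotz_diff x)) (fun n => M * (1 / 2) ^ n)).
  - intros n; now apply H.
  - apply is_lim_seq_const.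
  - replace (Finite 0) with (Rbar_mult M 0) by (simpl; f_equal; ring).
    apply is_lim_seq_scal_l, is_lim_seq_geom; rewrite Rabs_pos_eq; lra. }
simpl in H0; pose proof (Rabs_pos (herglotz_diff x)).
assert (E : herglotz_diff x = 0).
{ destruct (Req_dec (herglotz_diff x) 0) as [E|E]; [assumption|].
  pose proof (Rabs_pos_lt _ E); lra. }
unfold herglotz_diff in E; lra.
Qed.

(** * Derivatives of the cotangent *)

Definition is_Cderive (f : R -> C) (t : R) (l : C) : Prop :=
  is_derive (fun s => Re (f s)) t (Re l) /\ is_derive (fun s => Im (f s)) t (Im l).

Lemma is_Cderive_const (c : C) (t : R) : is_Cderive (fun _ => c) t 0%C.
Proof. split; apply (is_derive_const (V := R_NormedModule) _ t). Qed.

Lemma is_Cderive_RtoC (f : R -> R) (t l : R) :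
  is_derive f t l -> is_Cderive (fun s => RtoC (f s)) t (RtoC l).
Proof.
intros H; split; unfold Re, Im, RtoC; simpl; [exact H|].
apply (is_derive_const (V := R_NormedModule)).
Qed.

Lemma is_Cderive_plus (f g : R -> C) (t : R) (l m : C) :
  is_Cderive f t l -> is_Cderive g t m ->
  is_Cderive (fun s => f s + g s)%C t (l + m)%C.
Proof. intros [H1 H2] [H3 H4]; split; now apply (is_derive_plus (V := R_NormedModule)). Qed.

Lemma is_Cderive_mult (f g : R -> C) (t : R) (l m : C) :
  is_Cderive f t l -> is_Cderive g t m ->
  is_Cderive (fun s => f s * g s)%C t (l * g t + f t * m)%C.
Proof.
intros [H1 H2] [H3 H4]; split; unfold Re, Im, Cmult, Cplus in *; simpl.
- replace (fst l * fst (g t) - snd l * snd (g t) + (fst (f t) * fst m - snd (f t) * snd m))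
    with ((fst l * fst (g t) + fst (f t) * fst m)
          - (snd l * snd (g t) + snd (f t) * snd m)) by ring.
  apply (is_derive_minus (V := R_NormedModule));
    apply (is_derive_mult (K := R_AbsRing)); auto; apply Rmult_comm.
- replace (fst l * snd (g t) + snd l * fst (g t) + (fst (f t) * snd m + snd (f t) * fst m))
    with ((fst l * snd (g t) + fst (f t) * snd m)
          + (snd l * fst (g t) + snd (f t) * fst m)) by ring.
  apply (is_derive_plus (V := R_NormedModule));
    apply (is_derive_mult (K := R_AbsRing)); auto; apply Rmult_comm.
Qed.

Lemma is_Cderive_unique (f : R -> C) (t : R) (l m : C) :
  is_Cderive f t l -> is_Cderive f t m -> l = m.
Proof.
intros [H1 H2] [H3 H4].
apply is_derive_unique in H1; apply is_derive_unique in H2.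
apply is_derive_unique in H3; apply is_derive_unique in H4.
unfold Re, Im in *; destruct l, m; simpl in *; congruence.
Qed.

Lemma is_Cderive_ext_loc (f g : R -> C) (t : R) (l : C) :
  locally t (fun s => f s = g s) -> is_Cderive f t l -> is_Cderive g t l.
Proof.
intros H [H1 H2]; split.
- apply is_derive_ext_loc with (2 := H1).
  apply filter_imp with (2 := H); intros s Hs; now rewrite Hs.
- apply is_derive_ext_loc with (2 := H2).
  apply filter_imp with (2 := H); intros s Hs; now rewrite Hs.
Qed.

(** Polynomials in one variable, kept as formal expressions, so that evaluation at real
    and at complex arguments and the derivation below are plain recursions. *)
Inductive cot_poly : Set :=
  | cp_X
  | cp_const (c : R)
  | cp_add (p r : cot_poly)
  | cp_mul (p r : cot_poly).

Fixpoint cp_eval (p : cot_poly) (z : C) : C :=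
  match p with
  | cp_X => z
  | cp_const c => RtoC c
  | cp_add p r => (cp_eval p z + cp_eval r z)%C
  | cp_mul p r => (cp_eval p z * cp_eval r z)%C
  end.

(** The derivation of polynomials that sends [X] to [- (1 + X^2)], as differentiation
    does with the cotangent. *)
Fixpoint cp_deriv (p : cot_poly) : cot_poly :=
  match p with
  | cp_X => cp_mul (cp_const (-1)) (cp_add (cp_const 1) (cp_mul cp_X cp_X))
  | cp_const _ => cp_const 0
  | cp_add p r => cp_add (cp_deriv p) (cp_deriv r)
  | cp_mul p r => cp_add (cp_mul (cp_deriv p) r) (cp_mul p (cp_deriv r))
  end.

Definition cot_deriv (k : nat) : cot_poly := Nat.iter k cp_deriv cp_X.

(** Any solution of [g' = - kappa (1 + g^2)] turns [cp_deriv] into differentiation, up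
    to the factor [kappa]. It serves for the cotangent on the real axis and on a
    vertical line. *)
Lemma is_Cderive_cp_eval (g : R -> C) (kappa : C) (t : R) :
  is_Cderive g t (kappa * (- (1 + g t * g t)))%C ->
  forall p, is_Cderive (fun s => cp_eval p (g s)) t (kappa * cp_eval (cp_deriv p) (g t))%C.
Proof.
intros Hg; induction p as [|c|p IHp r IHr|p IHp r IHr].
- simpl.
  replace (kappa * (RtoC (-1) * (RtoC 1 + g t * g t)))%C
    with (kappa * (- (1 + g t * g t)))%C; [exact Hg|].
  replace (RtoC (-1)) with (- RtoC 1)%C by (rewrite <- RtoC_opp; reflexivity).
  ring.
- simpl; replace (kappa * RtoC 0)%C with (RtoC 0) by ring; apply is_Cderive_const.
- simpl; replace (kappa * (cp_eval (cp_deriv p) (g t) + cp_eval (cp_deriv r) (g t)))%C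
    with (kappa * cp_eval (cp_deriv p) (g t) + kappa * cp_eval (cp_deriv r) (g t))%C by ring.
  now apply is_Cderive_plus.
- simpl; replace (kappa * (cp_eval (cp_deriv p) (g t) * cp_eval r (g t) +
      cp_eval p (g t) * cp_eval (cp_deriv r) (g t)))%C
    with (kappa * cp_eval (cp_deriv p) (g t) * cp_eval r (g t) +
      cp_eval p (g t) * (kappa * cp_eval (cp_deriv r) (g t)))%C by ring.
  now apply is_Cderive_mult.
Qed.

Lemma is_Cderive_iter_cot (g : R -> C) (kappa : C) (t : R) (k : nat) :
  is_Cderive g t (kappa * (- (1 + g t * g t)))%C ->
  is_Cderive (fun s => kappa ^ k * cp_eval (cot_deriv k) (g s))%C t
    (kappa ^ S k * cp_eval (cot_deriv (S k)) (g t))%C.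
Proof.
intros Hg; rewrite Cpow_S.
replace (kappa * kappa ^ k * cp_eval (cot_deriv (S k)) (g t))%C
  with (0 * cp_eval (cot_deriv k) (g t)
        + kappa ^ k * (kappa * cp_eval (cot_deriv (S k)) (g t)))%C by ring.
apply (is_Cderive_mult (fun _ => (kappa ^ k)%C)); [apply is_Cderive_const|].
now apply is_Cderive_cp_eval.
Qed.

Definition cot_PI (x : R) : R := cos (PI * x) / sin (PI * x).

Lemma is_Cderive_cot_PI (x : R) : 0 < x < 1 ->
  is_Cderive (fun y => RtoC (cot_PI y)) x
    (RtoC PI * (- (1 + RtoC (cot_PI x) * RtoC (cot_PI x))))%C.
Proof.
intros Hx; rewrite <- RtoC_mult, <- RtoC_plus, <- RtoC_opp, <- RtoC_mult.
apply is_Cderive_RtoC; unfold cot_PI.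
pose proof (sin_PI_pos x Hx); auto_derive; [lra|].
rewrite !Rdiv_def; field; lra.
Qed.

(** The base case is [1 / sin^2 = 1 + cot^2]; the step differentiates both sides. *)
Lemma bilateral_cot (k : nat) (x : R) : (1 <= k)%nat -> 0 < x < 1 ->
  RtoC ((-1) ^ k * (INR (fact k) * bilateral (k + 1) x)) =
  (RtoC PI * (RtoC PI ^ k * cp_eval (cot_deriv k) (RtoC (cot_PI x))))%C.
Proof.
intros Hk; destruct k as [|k]; [lia|clear Hk].
revert x; induction k as [|k IH]; intros x Hx.
- change (1 + 1)%nat with 2%nat; rewrite bilateral_2_sin by assumption.
  simpl cp_eval; rewrite <- RtoC_pow, <- !RtoC_mult, <- !RtoC_plus, <- !RtoC_mult; f_equal.
  pose proof (sin_PI_pos x Hx) as Hs; pose proof (sin2_cos2 (PI * x)) as E.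
  unfold Rsqr in E; unfold cot_PI; simpl.
  replace (cos (PI * x) / sin (PI * x) * (cos (PI * x) / sin (PI * x)))
    with ((1 - sin (PI * x) * sin (PI * x)) / (sin (PI * x) * sin (PI * x)))
    by (rewrite <- E; field; lra).
  field; lra.
- assert (H1 := IH x Hx).
  assert (D1 : is_Cderive
    (fun y => RtoC ((-1) ^ S k * (INR (fact (S k)) * bilateral (S k + 1) y))) x
    (RtoC ((-1) ^ S (S k) * (INR (fact (S (S k))) * bilateral (S (S k) + 1) x)))).
  { apply is_Cderive_RtoC.
    replace ((-1) ^ S (S k) * (INR (fact (S (S k))) * bilateral (S (S k) + 1) x))
      with ((-1) ^ S k * (INR (fact (S k)) * (- INR (S k + 1) * bilateral (S (S k + 1)) x))).
    - do 2 apply is_derive_scal; apply is_derive_bilateral; [lia|assumption].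
    - replace (fact (S (S k))) with ((S k + 1) * fact (S k))%nat
        by (now rewrite Nat.add_1_r).
      replace (S (S k) + 1)%nat with (S (S k + 1)) by lia.
      rewrite mult_INR, <- (tech_pow_Rmult (-1) (S k)); ring. }
  apply (is_Cderive_unique _ x _ _ D1).
  apply (is_Cderive_ext_loc (fun y =>
    (RtoC PI * (RtoC PI ^ S k * cp_eval (cot_deriv (S k)) (RtoC (cot_PI y))))%C)).
  { apply filter_imp with (2 := filter_and _ _ (open_gt 0 x (proj1 Hx)) (open_lt 1 x (proj2 Hx))).
    intros y Hy; symmetry; now apply IH. }
  replace (RtoC PI * (RtoC PI ^ S (S k) * cp_eval (cot_deriv (S (S k))) (RtoC (cot_PI x))))%C
    with (0 * (RtoC PI ^ S k * cp_eval (cot_deriv (S k)) (RtoC (cot_PI x))) +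
      RtoC PI * (RtoC PI ^ S (S k) * cp_eval (cot_deriv (S (S k))) (RtoC (cot_PI x))))%C by ring.
  apply (is_Cderive_mult (fun _ => RtoC PI)); [apply is_Cderive_const|].
  apply (is_Cderive_iter_cot (fun y => RtoC (cot_PI y))); now apply is_Cderive_cot_PI.
Qed.

(** * Smoothness of the generating function *)

(** [n]-fold differentiability on the whole line, by successive derivatives: products
    and inverses follow by induction on [n], without Leibniz's formula. *)
Fixpoint differentiable_n (n : nat) (f : R -> R) : Prop :=
  match n with
  | O => True
  | S n => exists f', (forall x, is_derive f x (f' x)) /\ differentiable_n n f'
  end.

Lemma differentiable_n_ext (n : nat) (f g : R -> R) :
  (forall x, f x = g x) -> differentiable_n n f -> differentiable_n n g.
Proof.
destruct n as [|n]; [auto|].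
intros H [f' [H1 H2]]; exists f'; split; [|assumption].
intros x; now apply (is_derive_ext f).
Qed.

Lemma differentiable_n_pred (n : nat) (f : R -> R) :
  differentiable_n (S n) f -> differentiable_n n f.
Proof.
revert f; induction n as [|n IH]; intros f; [simpl; auto|].
intros [f' [H1 H2]]; exists f'; split; [assumption | now apply IH].
Qed.

Lemma differentiable_n_plus (n : nat) (f g : R -> R) :
  differentiable_n n f -> differentiable_n n g ->
  differentiable_n n (fun x => f x + g x).
Proof.
revert f g; induction n as [|n IH]; intros f g; [simpl; auto|].
intros [f' [H1 H2]] [g' [H3 H4]]; exists (fun x => f' x + g' x); split; [|now apply IH].
intros x; now apply (is_derive_plus (V := R_NormedModule)).
Qed.

Lemma differentiable_n_mult (n : nat) (f g : R -> R) :
  differentiable_n n f -> differentiable_n n g ->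
  differentiable_n n (fun x => f x * g x).
Proof.
revert f g; induction n as [|n IH]; intros f g; [simpl; auto|].
intros Hf Hg.
assert (Hf0 := differentiable_n_pred _ _ Hf).
assert (Hg0 := differentiable_n_pred _ _ Hg).
destruct Hf as [f' [H1 H2]]; destruct Hg as [g' [H3 H4]].
exists (fun x => f' x * g x + f x * g' x); split.
- intros x; apply (is_derive_mult (K := R_AbsRing)); auto; apply Rmult_comm.
- apply differentiable_n_plus; now apply IH.
Qed.

Lemma differentiable_n_const (n : nat) (c : R) : differentiable_n n (fun _ => c).
Proof.
revert c; induction n as [|n IH]; intros c; [simpl; auto|].
exists (fun _ => 0); split; [|apply IH].
intros x; apply (is_derive_const (V := R_NormedModule)).
Qed.

Lemma differentiable_n_inv (n : nat) (f : R -> R) : (forall x, f x <> 0) ->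
  differentiable_n n f -> differentiable_n n (fun x => / f x).
Proof.
intros H0; induction n as [|n IH]; intros Hf; [simpl; auto|].
assert (Hi := IH (differentiable_n_pred _ _ Hf)).
destruct Hf as [f' [H1 H2]].
exists (fun x => - 1 * f' x * (/ f x * / f x)); split.
- intros x; replace (- 1 * f' x * (/ f x * / f x)) with (- f' x / f x ^ 2)
    by (field; apply H0).
  now apply is_derive_inv.
- repeat apply differentiable_n_mult; auto; apply differentiable_n_const.
Qed.

Lemma differentiable_n_exp (n : nat) (c : R) : differentiable_n n (fun t => exp (t * c)).
Proof.
induction n as [|n IH]; [simpl; auto|].
exists (fun t => exp (t * c) * c); split.
- intros x; auto_derive; [auto | ring].
- apply differentiable_n_mult; [assumption | apply differentiable_n_const].
Qed.

Lemma differentiable_n_PSeries (n : nat) (a : nat -> R) :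
  CV_radius a = p_infty -> differentiable_n n (PSeries a).
Proof.
revert a; induction n as [|n IH]; intros a Ha; [simpl; auto|].
exists (PSeries (PS_derive a)); split.
- intros x; apply is_derive_PSeries; now rewrite Ha.
- apply IH; now rewrite CV_radius_derive.
Qed.

Lemma differentiable_n_ex_derive (n : nat) (f : R -> R) :
  differentiable_n (S n) f -> forall x, ex_derive (Derive_n f n) x.
Proof.
revert f; induction n as [|n IH]; intros f [f' [H1 H2]] x.
- eexists; apply H1.
- apply ex_derive_ext with (Derive_n f' n); [|now apply IH].
  intros t; replace (S n) with (n + 1)%nat by lia.
  rewrite <- Derive_n_comp; apply Derive_n_ext.
  intros s; symmetry; apply is_derive_unique, H1.
Qed.

Definition expm1_quot (t : R) : R := if Req_EM_T t 0 then 1 else (exp t - 1) / t.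

Lemma expm1_quot_mult (t : R) : t * expm1_quot t = exp t - 1.
Proof.
unfold expm1_quot; destruct (Req_EM_T t 0) as [->|Ht].
- rewrite exp_0; ring.
- field; assumption.
Qed.

Lemma expm1_quot_neq_0 (t : R) : expm1_quot t <> 0.
Proof.
unfold expm1_quot; destruct (Req_EM_T t 0) as [|Ht]; [lra|].
intros H; apply Ht, exp_inv; rewrite exp_0.
apply (Rmult_eq_compat_r t) in H; unfold Rdiv in H.
rewrite Rmult_assoc, Rinv_l, Rmult_0_l in H by assumption; lra.
Qed.

Lemma CV_radius_exp : CV_radius (fun n => / INR (fact n)) = p_infty.
Proof.
assert (H : forall n, INR (fact n) <> 0) by (intros; apply INR_fact_neq_0).
apply CV_radius_infinite_DAlembert.
- intros n; now apply Rinv_neq_0_compat.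
- apply (is_lim_seq_ext (fun n => 1 * / (INR n + 1))); [|apply is_lim_seq_inv_succ].
  intros n; rewrite fact_simpl, mult_INR, S_INR; pose proof (pos_INR n).
  replace (/ ((INR n + 1) * INR (fact n)) / / INR (fact n)) with (1 * / (INR n + 1))
    by (field; split; [apply H|lra]).
  symmetry; apply Rabs_pos_eq.
  rewrite Rmult_1_l; left; apply Rinv_0_lt_compat; lra.
Qed.

Lemma expm1_quot_PSeries (t : R) :
  PSeries (PS_decr_1 (fun n => / INR (fact n))) t = expm1_quot t.
Proof.
destruct (Req_dec t 0) as [->|Ht].
- rewrite PSeries_0; unfold expm1_quot; destruct Req_EM_T; [|lra].
  unfold PS_decr_1; simpl; field.
- apply (Rmult_eq_reg_l t); [|assumption].
  rewrite expm1_quot_mult, exp_Reals, (PSeries_decr_1 (fun n => / INR (fact n))) by (eexists; apply is_exp_Reals).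
  simpl; field.
Qed.

Lemma bernoulli_gf_eq (x t : R) : bernoulli_gf x t = exp (t * x) * / expm1_quot t.
Proof.
pose proof (expm1_quot_neq_0 t) as H0.
unfold bernoulli_gf, expm1_quot in *; destruct (Req_EM_T t 0) as [->|Ht].
- rewrite Rmult_0_l, exp_0; field.
- field; split; [assumption|].
  intros H; apply H0; rewrite H; field; assumption.
Qed.

(** The singularity at [0] disappears in [e^(t x) / ((e^t - 1) / t)], whose denominator
    is an everywhere convergent power series without real zeros. *)
Lemma bernoulli_gf_smooth (x : R) (n : nat) (t : R) :
  ex_derive (Derive_n (bernoulli_gf x) n) t.
Proof.
apply differentiable_n_ex_derive.
apply differentiable_n_ext with (fun t => exp (t * x) * / expm1_quot t).
{ intros; symmetry; apply bernoulli_gf_eq. }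
apply differentiable_n_mult; [apply differentiable_n_exp|].
apply differentiable_n_inv; [apply expm1_quot_neq_0|].
apply differentiable_n_ext with (1 := expm1_quot_PSeries).
apply differentiable_n_PSeries; rewrite CV_radius_decr_1; apply CV_radius_exp.
Qed.

(** * Exponential sums of Bernoulli polynomials *)

Lemma is_derive_sum_n_m_1 (f : nat -> R -> R) (d : nat -> R) (N : nat) (t : R) :
  (forall s, is_derive (f s) t (d s)) ->
  is_derive (fun x => sum_n_m (fun s => f s x) 1 N) t (sum_n_m d 1 N).
Proof.
intros H; induction N as [|N IH].
- rewrite sum_n_m_zero by lia.
  apply is_derive_ext with (fun _ => 0).
  { intros; symmetry; apply (sum_n_m_zero (G := R_AbelianMonoid)); lia. }
  apply (is_derive_const (V := R_NormedModule)).
- rewrite sum_n_Sm by lia.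
  apply is_derive_ext with (fun x => plus (sum_n_m (fun s => f s x) 1 N) (f (S N) x)).
  { intros; symmetry; apply (sum_n_Sm (G := R_AbelianMonoid)); lia. }
  apply (is_derive_plus (V := R_NormedModule)); auto.
Qed.

(** A family [F] in which each member differentiates to the next determines all
    derivatives of [F 0]; those of a linear combination can then be read off. *)
Lemma sum_Derive_n (g : nat -> R -> R) (c : nat -> R) (F : nat -> R -> R) (N : nat) :
  (forall s n t, ex_derive (Derive_n (g s) n) t) ->
  (forall n t, is_derive (F n) t (F (S n) t)) ->
  (forall t, sum_n_m (fun s => g s t * c s) 1 N = F O t) ->
  forall n t, sum_n_m (fun s => Derive_n (g s) n t * c s) 1 N = F n t.
Proof.
intros Hg HF H0; induction n as [|n IH]; intros t; [apply H0|].
rewrite <- (is_derive_unique _ _ _ (HF n t)).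
symmetry; apply is_derive_unique.
apply is_derive_ext with (1 := IH).
apply (is_derive_sum_n_m_1 (fun s t => Derive_n (g s) n t * c s)).
intros s; apply (is_derive_scal_l (V := R_NormedModule) (Derive_n (g s) n)).
apply (Derive_correct (Derive_n (g s) n)), Hg.
Qed.

Section ExponentialSum.

Variables (q : nat) (theta : R).
Hypothesis q_pos : (0 < q)%nat.
Hypothesis cos_theta : cos theta < 1.
Hypothesis cos_q_theta : cos (INR q * theta) = 1.
Hypothesis sin_q_theta : sin (INR q * theta) = 0.

Let q_pos_R : 0 < INR q.
Proof. now apply lt_0_INR. Qed.

(** [|r - 1|^2 / (2 |r|)] for [r = exp (t / q + i theta)]. *)
Definition cosh_sub_cos (t : R) : R :=
  (exp (t / INR q) + exp (- (t / INR q))) / 2 - cos theta.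

Lemma cosh_sub_cos_pos (t : R) : 0 < cosh_sub_cos t.
Proof.
unfold cosh_sub_cos; rewrite exp_Ropp.
set (e := exp (t / INR q)); assert (0 < e) by apply exp_pos.
assert (2 <= e + / e); [|lra].
apply (Rmult_le_reg_r e); [assumption|].
replace ((e + / e) * e) with (e * e + 1) by (field; lra).
pose proof (pow2_ge_0 (e - 1)); nra.
Qed.

(** [cot (theta / 2 - i t / (2 q))], in real and imaginary parts. *)
Definition cot_line (t : R) : C :=
  (sin theta / cosh_sub_cos t,
   (exp (t / INR q) - exp (- (t / INR q))) / 2 / cosh_sub_cos t).

Definition cot_line_speed : C := (0, - / (2 * INR q)).

(** From [cosh^2 - sinh^2 = 1] and [cos^2 + sin^2 = 1]. *)
Lemma is_Cderive_cot_line (t : R) :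
  is_Cderive cot_line t
    (cot_line_speed * (- (1 + cot_line t * cot_line t)))%C.
Proof.
pose proof (cosh_sub_cos_pos t) as HD.
assert (Hs : sin theta ^ 2 = 1 - cos theta ^ 2).
{ pose proof (sin2_cos2 theta) as H; unfold Rsqr in H; simpl; lra. }
assert (He : exp (- (t / INR q)) = / exp (t / INR q)) by apply exp_Ropp.
assert (H0 := exp_pos (t / INR q)).
split; unfold cot_line, cot_line_speed, Cmult, Copp, Cplus, RtoC; simpl;
  unfold cosh_sub_cos in *; auto_derive; try (split; [lra|auto]); try lra;
  rewrite <- !Rdiv_def; rewrite He in *.
all: set (e := exp (t / INR q)) in *; set (s := sin theta) in *;
  set (c := cos theta) in *.
all: set (Ch := (e + / e) / 2) in *; set (Sh := (e - / e) / 2) in *.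
all: assert (HCS : Ch ^ 2 - Sh ^ 2 = 1) by (unfold Ch, Sh; field; lra).
all: replace ((1 / INR q * e + - (1 / INR q) * / e) / 2) with (Sh / INR q)
  by (unfold Sh; field; lra).
- unfold Rminus in *; field; lra.
- replace ((1 / INR q * e + - (- (1 / INR q) * / e)) / 2) with (Ch / INR q)
    by (unfold Ch; field; lra).
  replace ((e + - / e) / 2) with Sh by reflexivity.
  apply Rminus_diag_uniq.
  match goal with |- ?l = 0 => replace l with
    ((2 * Ch * (Ch - c) - Sh ^ 2 - (Ch - c) ^ 2 - s ^ 2) / (2 * INR q * (Ch - c) ^ 2))
    by (field; lra) end.
  replace (2 * Ch * (Ch - c) - Sh ^ 2 - (Ch - c) ^ 2 - s ^ 2)
    with (Ch ^ 2 - Sh ^ 2 - (c ^ 2 + s ^ 2)) by ring.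
  rewrite HCS, Hs; unfold Rdiv; ring.
Qed.

Definition minus_half_i : C := (0, - / 2).

(** [r / (r - 1)] for [r = exp (t / q + i theta)], expressed by [cot_line], from which
    it inherits its derivatives. *)
Definition geom_quot (t : R) : C := (RtoC (1 / 2) + minus_half_i * cot_line t)%C.

(** [r^s] for [r = exp (t / q + i theta)]. *)
Definition wave (s : nat) (t : R) : C :=
  (exp (t * (INR s / INR q)) * cos (INR s * theta),
   exp (t * (INR s / INR q)) * sin (INR s * theta)).

Lemma wave_succ (s : nat) (t : R) : wave (S s) t = (wave 1 t * wave s t)%C.
Proof.
unfold wave, Cmult; cbn [fst snd]; rewrite S_INR; simpl (INR 1).
replace (t * ((INR s + 1) / INR q)) with (t * (INR s / INR q) + t * (1 / INR q)) by (field; lra).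
rewrite Rmult_plus_distr_r, Rmult_1_l, exp_plus, cos_plus, sin_plus; f_equal; ring.
Qed.

(** This is [u = r / (r - 1)] with the denominator cleared. *)
Lemma geom_quot_spec (t : R) : (wave 1 t * geom_quot t = wave 1 t + geom_quot t)%C.
Proof.
pose proof (cosh_sub_cos_pos t) as HD.
unfold wave, geom_quot, cot_line, minus_half_i, Cmult, Cplus, RtoC; cbn [fst snd].
simpl (INR 1); rewrite Rmult_1_l.
replace (t * (1 / INR q)) with (t / INR q) by (field; lra).
unfold cosh_sub_cos in *; rewrite exp_Ropp in *.
assert (Hs : sin theta ^ 2 = 1 - cos theta ^ 2).
{ pose proof (sin2_cos2 theta) as H; unfold Rsqr in H; simpl; lra. }
assert (H0 := exp_pos (t / INR q)).
set (e := exp (t / INR q)) in *; set (s := sin theta) in *;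
  set (c := cos theta) in *.
assert (HE : e * ((e + / e) / 2 - c) = (e ^ 2 + 1) / 2 - e * c) by (field; lra).
set (D := (e + / e) / 2 - c) in *.
assert (HI : / e = 2 * D + 2 * c - e) by (unfold D; field; lra).
rewrite HI.
assert (HE2 : e * (2 * D + 2 * c - e) = 1) by (rewrite <- HI; field; lra).
f_equal; apply Rminus_diag_uniq; match goal with |- ?l = 0 => set (lhs := l) end.
(* Each numerator is a combination of [e * / e = 1] and [cos^2 + sin^2 = 1]. *)
- replace lhs with (((1 - e * (2 * D + 2 * c - e)) * c + e * (s ^ 2 - (1 - c ^ 2)))
    / (2 * D)) by (unfold lhs; field; lra).
  rewrite HE2, Hs; unfold Rdiv; ring.
- replace lhs with (s * (1 - e * (2 * D + 2 * c - e)) / (2 * D))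
    by (unfold lhs; field; lra).
  rewrite HE2; unfold Rdiv; ring.
Qed.

Lemma sum_wave (n : nat) (t : R) :
  (sum_n_m (fun s => Re (wave s t)) 1 n, sum_n_m (fun s => Im (wave s t)) 1 n)
  = ((wave n t - 1) * geom_quot t)%C.
Proof.
induction n as [|n IH].
- rewrite !sum_n_m_zero by lia.
  assert (E : wave 0 t = RtoC 1).
  { unfold wave, RtoC; simpl.
    replace (t * (0 / INR q)) with 0 by (unfold Rdiv; ring).
    rewrite Rmult_0_l, exp_0, cos_0, sin_0; f_equal; ring. }
  rewrite E; unfold zero; simpl.
  match goal with |- @eq _ ?a ?b => change (@eq C (RtoC 0) b) end; ring.
- rewrite !sum_n_Sm by lia.
  change ((sum_n_m (fun s => Re (wave s t)) 1 n, sum_n_m (fun s => Im (wave s t)) 1 n)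
    + wave (S n) t = (wave (S n) t - 1) * geom_quot t)%C.
  rewrite IH, wave_succ.
  replace ((wave 1 t * wave n t - 1) * geom_quot t)%C
    with (wave n t * (wave 1 t * geom_quot t) - geom_quot t)%C by ring.
  rewrite geom_quot_spec; ring.
Qed.

(** The geometric sum is [(e^t - 1) * geom_quot t], since [r^q = e^t]; the factor
    [e^t - 1] cancels the denominator of the generating functions. *)
Lemma sum_bernoulli_gf (t : R) :
  (sum_n_m (fun s => bernoulli_gf (INR s / INR q) t * cos (INR s * theta)) 1 q,
   sum_n_m (fun s => bernoulli_gf (INR s / INR q) t * sin (INR s * theta)) 1 q)
  = (RtoC t * geom_quot t)%C.
Proof.
assert (Hq : wave q t = RtoC (exp t)).
{ unfold wave, RtoC; rewrite cos_q_theta, sin_q_theta.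
  replace (t * (INR q / INR q)) with t by (field; lra); f_equal; ring. }
pose proof (sum_wave q t) as H; rewrite Hq in H.
pose proof (expm1_quot_neq_0 t) as H0.
assert (Hc : forall f : R -> R,
  sum_n_m (fun s => bernoulli_gf (INR s / INR q) t * f (INR s * theta)) 1 q
  = / expm1_quot t
    * sum_n_m (fun s => exp (t * (INR s / INR q)) * f (INR s * theta)) 1 q).
{ intros f; rewrite <- (sum_n_m_mult_l (K := R_Ring)).
  apply sum_n_m_ext; intros s; rewrite bernoulli_gf_eq; unfold mult; simpl; ring. }
rewrite !Hc.
transitivity (RtoC (/ expm1_quot t) * ((RtoC (exp t) - 1) * geom_quot t))%C.
- rewrite <- H; unfold Cmult, RtoC; simpl; f_equal; ring.
- rewrite <- RtoC_minus, <- expm1_quot_mult, RtoC_mult, RtoC_inv by assumption.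
  eq_in_C; field; intros E; apply H0; now apply (f_equal Re) in E.
Qed.

(** The [n]-th derivative of [geom_quot]: the constant [1/2] contributes for [n = 0]
    only. *)
Definition geom_quot_deriv (n : nat) (t : R) : C :=
  (match n with O => RtoC (1 / 2) | S _ => 0 end
   + minus_half_i * (cot_line_speed ^ n * cp_eval (cot_deriv n) (cot_line t)))%C.

Lemma is_Cderive_geom_quot (n : nat) (t : R) :
  is_Cderive (geom_quot_deriv n) t (geom_quot_deriv (S n) t).
Proof.
apply is_Cderive_plus; [apply is_Cderive_const|].
replace (minus_half_i * (cot_line_speed ^ S n * cp_eval (cot_deriv (S n)) (cot_line t)))%C
  with (0 * (cot_line_speed ^ n * cp_eval (cot_deriv n) (cot_line t))
    + minus_half_i * (cot_line_speed ^ S n * cp_eval (cot_deriv (S n)) (cot_line t)))%C by ring.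
apply (is_Cderive_mult (fun _ => minus_half_i)); [apply is_Cderive_const|].
apply is_Cderive_iter_cot, is_Cderive_cot_line.
Qed.

(** The [n]-th derivative of [t * geom_quot t], by Leibniz's rule. *)
Definition id_geom_quot_deriv (n : nat) (t : R) : C :=
  (RtoC t * geom_quot_deriv n t + RtoC (INR n) * geom_quot_deriv (pred n) t)%C.

Lemma is_Cderive_id_geom_quot (n : nat) (t : R) :
  is_Cderive (id_geom_quot_deriv n) t (id_geom_quot_deriv (S n) t).
Proof.
assert (H : id_geom_quot_deriv (S n) t =
  (RtoC 1 * geom_quot_deriv n t + RtoC t * geom_quot_deriv (S n) t
   + (0 * geom_quot_deriv (pred n) t
      + RtoC (INR n) * geom_quot_deriv (S (pred n)) t))%C).
{ unfold id_geom_quot_deriv; rewrite S_INR, RtoC_plus; simpl (pred (S n)).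
  destruct n as [|n]; simpl (pred _); [simpl (INR 0)|]; ring. }
rewrite H.
apply is_Cderive_plus.
- apply (is_Cderive_mult (fun t => RtoC t)); [|apply is_Cderive_geom_quot].
  apply (is_Cderive_RtoC (fun t => t)), (is_derive_id (K := R_AbsRing)).
- apply (is_Cderive_mult (fun _ => RtoC (INR n))); [|apply is_Cderive_geom_quot].
  apply is_Cderive_const.
Qed.

(** Bernoulli polynomials are the derivatives of their generating function at [0], where
    those of [t * geom_quot t] reduce to [(k + 1)] times the [k]-th derivative of
    [geom_quot]. *)
Lemma sum_bernoulli (k : nat) : (1 <= k)%nat ->
  (sum_n_m (fun s => bernoulli (k + 1) (INR s / INR q) * cos (INR s * theta)) 1 q,
   sum_n_m (fun s => bernoulli (k + 1) (INR s / INR q) * sin (INR s * theta)) 1 q)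
  = (RtoC (INR (k + 1)) * (minus_half_i * (cot_line_speed ^ k
       * cp_eval (cot_deriv k) (RtoC (sin theta / (1 - cos theta))))))%C.
Proof.
intros Hk.
assert (H0 : forall t, (RtoC t * geom_quot t)%C = id_geom_quot_deriv 0 t).
{ intros t; unfold id_geom_quot_deriv, geom_quot_deriv, geom_quot; simpl; ring. }
transitivity (id_geom_quot_deriv (k + 1) 0).
- rewrite (surjective_pairing (id_geom_quot_deriv _ _)); f_equal.
  + apply (sum_Derive_n (fun s => bernoulli_gf (INR s / INR q)) (fun s => cos (INR s * theta))
      (fun n t => Re (id_geom_quot_deriv n t))).
    * intros; apply bernoulli_gf_smooth.
    * intros n t; apply is_Cderive_id_geom_quot.
    * intros t; rewrite <- H0, <- sum_bernoulli_gf; reflexivity.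
  + apply (sum_Derive_n (fun s => bernoulli_gf (INR s / INR q)) (fun s => sin (INR s * theta))
      (fun n t => Im (id_geom_quot_deriv n t))).
    * intros; apply bernoulli_gf_smooth.
    * intros n t; apply is_Cderive_id_geom_quot.
    * intros t; rewrite <- H0, <- sum_bernoulli_gf; reflexivity.
- assert (E : cot_line 0 = RtoC (sin theta / (1 - cos theta))).
  { unfold cot_line, cosh_sub_cos, RtoC.
    replace (0 / INR q) with 0 by (unfold Rdiv; ring); rewrite Ropp_0, exp_0.
    f_equal; field; lra. }
  unfold id_geom_quot_deriv, geom_quot_deriv; rewrite E.
  rewrite Nat.add_1_r; simpl (pred _); destruct k as [|k]; [lia|]; eq_in_C; ring.
Qed.

End ExponentialSum.

(** * The reflection formula at rational points *)

Lemma cot_line_speed_pow_double (q m : nat) : (0 < q)%nat ->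
  (cot_line_speed q ^ (2 * m))%C = RtoC ((-1) ^ m / (2 * INR q) ^ (2 * m)).
Proof.
intros Hq; assert (0 < INR q) by now apply lt_0_INR.
rewrite Cpow_mult_r, pow_mult.
unfold Rdiv; rewrite <- pow_inv, <- Rpow_mult_distr, RtoC_pow; f_equal.
unfold cot_line_speed, Cpow, Cmult, RtoC; simpl; f_equal; field; lra.
Qed.

(** Both sides are multiples of the same number [P_k (cot (PI x))], which is real. The
    coefficient [(- i / 2) (- i / (2 q))^k] of [sum_bernoulli] is real for odd [k] and
    imaginary for even [k], matching the choice of the cosine or the sine. *)
Lemma sum_bernoulli_trig (q k : nat) (x : R) : (1 <= k)%nat -> (0 < q)%nat ->
  0 < x < 1 -> cos (INR q * (2 * PI * x)) = 1 -> sin (INR q * (2 * PI * x)) = 0 ->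
  INR (fact k) * bilateral (k + 1) x =
  - (-1) ^ ((k + 1) / 2) * ((2 * PI * INR q) ^ (k + 1) / (INR q * INR (k + 1)))
  * sum_n_m (fun s => bernoulli (k + 1) (INR s / INR q)
                      * f_trig (k + 1) (INR s * (2 * PI * x))) 1 q.
Proof.
intros Hk Hq Hx Hcos Hsin.
assert (HqR : 0 < INR q) by now apply lt_0_INR.
assert (HkR : 0 < INR (k + 1)) by (apply lt_0_INR; lia).
pose proof PI_RGT_0 as HPI.
pose proof (sin_PI_pos x Hx) as Hs.
assert (Hdouble : 2 * PI * x = 2 * (PI * x)) by ring.
assert (Hcos1 : 1 - cos (2 * PI * x) = 2 * sin (PI * x) * sin (PI * x)).
{ rewrite Hdouble, cos_2a_sin; ring. }
assert (Hcot : sin (2 * PI * x) / (1 - cos (2 * PI * x)) = cot_PI x).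
{ rewrite Hcos1, Hdouble, sin_2a; unfold cot_PI; field; lra. }
assert (Hlt : cos (2 * PI * x) < 1).
{ pose proof (Rmult_lt_0_compat _ _ Hs Hs); lra. }
pose proof (sum_bernoulli q (2 * PI * x) Hq Hlt Hcos Hsin k Hk) as HB.
rewrite Hcot in HB.
pose proof (bilateral_cot k x Hk Hx) as HE.
set (P := cp_eval (cot_deriv k) (RtoC (cot_PI x))) in *.
assert (HPk : 0 < PI * PI ^ k) by (apply Rmult_lt_0_compat; [|apply pow_lt]; assumption).
rewrite <- RtoC_pow in HE.
set (p := Re P).
assert (HP : P = RtoC p).
{ (* [P] is real because the bilateral sum is. *)
  rewrite (surjective_pairing P); unfold p, RtoC, Re; f_equal.
  rewrite Cmult_assoc, <- RtoC_mult in HE.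
  apply (f_equal Im) in HE; rewrite im_RtoC, im_scal_l in HE; unfold Im in HE.
  symmetry in HE; apply Rmult_integral in HE; destruct HE; lra. }
assert (HEp : (-1) ^ k * (INR (fact k) * bilateral (k + 1) x) = PI * PI ^ k * p).
{ rewrite HP, <- !RtoC_mult in HE.
  apply (f_equal Re) in HE; rewrite !re_RtoC in HE; rewrite HE; ring. }
clear HE; rewrite HP in HB.
destruct (Nat.Even_or_Odd k) as [[m Em]|[m Em]].
- assert (Hev : Nat.even (k + 1) = false).
  { rewrite Em, Nat.add_1_r, Nat.even_succ, Nat.odd_mul; reflexivity. }
  unfold f_trig; rewrite Hev.
  apply (f_equal Im) in HB; unfold Im at 1 in HB; cbn [snd] in HB; rewrite HB.
  assert (Hpow : (-1) ^ k = 1) by (rewrite Em; apply pow_1_even).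
  rewrite Hpow, Rmult_1_l in HEp; rewrite HEp.
  assert (Hspeed : (cot_line_speed q ^ k)%C = RtoC ((-1) ^ m / (2 * INR q) ^ k)).
  { rewrite Em; now apply cot_line_speed_pow_double. }
  rewrite Hspeed.
  replace ((k + 1) / 2)%nat with m.
  2: { apply (Nat.div_unique _ _ _ 1); lia. }
  rewrite <- RtoC_mult, im_scal_l, im_scal_r; unfold minus_half_i, Im; cbn [snd].
  rewrite pow_add, !Rpow_mult_distr.
  assert (Hm : (-1) ^ m * (-1) ^ m = 1).
  { rewrite <- Rpow_mult_distr; replace (-1 * -1) with 1 by ring; apply pow1. }
  assert (INR q ^ k <> 0) by (apply pow_nonzero; lra).
  assert (2 ^ k <> 0) by (apply pow_nonzero; lra).
  transitivity (((-1) ^ m * (-1) ^ m) * (PI * PI ^ k * p)); [rewrite Hm; ring|].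
  field; repeat split; try assumption; lra.
- assert (Hev : Nat.even (k + 1) = true).
  { apply Nat.even_spec; exists (S m); lia. }
  unfold f_trig; rewrite Hev.
  apply (f_equal Re) in HB; unfold Re at 1 in HB; cbn [fst] in HB; rewrite HB.
  assert (HEp' : INR (fact k) * bilateral (k + 1) x = - (PI * PI ^ k * p)).
  { rewrite <- HEp; assert (Hpow : (-1) ^ k = -1)
      by (rewrite Em, Nat.add_1_r; apply pow_1_odd).
    rewrite Hpow; ring. }
  rewrite HEp'.
  assert (Hspeed : (cot_line_speed q ^ k)%C =
    (cot_line_speed q * RtoC ((-1) ^ m / (2 * INR q) ^ (2 * m)))%C).
  { rewrite Em, Nat.add_1_r, Cpow_S, cot_line_speed_pow_double; auto. }
  rewrite Hspeed.
  replace ((k + 1) / 2)%nat with (S m).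
  2: { apply (Nat.div_unique _ _ _ 0); lia. }
  replace (minus_half_i * (cot_line_speed q * RtoC ((-1) ^ m / (2 * INR q) ^ (2 * m)) * RtoC p))%C
    with (RtoC (- / (4 * INR q) * ((-1) ^ m / (2 * INR q) ^ (2 * m)) * p)).
  2: { unfold minus_half_i, cot_line_speed, Cmult, RtoC; simpl; f_equal.
       - field; split; [|lra]; apply pow_nonzero; lra.
       - ring. }
  rewrite <- RtoC_mult, re_RtoC.
  replace (PI * PI ^ k) with (PI ^ (2 * m) * PI ^ 2) by (rewrite Em, Nat.add_1_r; simpl; ring).
  replace ((2 * PI * INR q) ^ (k + 1))
    with (2 ^ (2 * m) * PI ^ (2 * m) * INR q ^ (2 * m) * (2 * PI * INR q) ^ 2).
  2: { rewrite Em, <- Nat.add_assoc, pow_add, !(Rpow_mult_distr _ _ (2 * m)); reflexivity. }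
  rewrite !(Rpow_mult_distr _ _ (2 * m)).
  assert (Hm : (-1) ^ m * (-1) ^ m = 1).
  { rewrite <- Rpow_mult_distr; replace (-1 * -1) with 1 by ring; apply pow1. }
  assert (INR q ^ (2 * m) <> 0) by (apply pow_nonzero; lra).
  assert (2 ^ (2 * m) <> 0) by (apply pow_nonzero; lra).
  transitivity (((-1) ^ m * (-1) ^ m) * - (PI ^ (2 * m) * PI ^ 2 * p)); [rewrite Hm; ring|].
  simpl ((-1) ^ S m).
  field; repeat split; try assumption; lra.
Qed.

Lemma fractional_part_bounds (alpha : Q) : ~ is_integer alpha ->
  0 < Q2R (Qfrac alpha) < 1 /\
  Q2R (Qfrac alpha) = Q2R alpha - IZR (Qfloor alpha).
Proof.
intros Hint.
assert (E : Q2R (Qfrac alpha) = Q2R alpha - IZR (Qfloor alpha)).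
{ unfold Qfrac; rewrite Q2R_minus; unfold inject_Z, Q2R at 2; simpl; field. }
split; [|exact E]; rewrite E.
pose proof (Qle_Rle _ _ (Qfloor_le alpha)) as H1.
pose proof (Qlt_Rlt _ _ (Qlt_floor alpha)) as H2.
unfold inject_Z in H1, H2; unfold Q2R at 1 in H1; unfold Q2R at 2 in H2; simpl in H1, H2.
rewrite plus_IZR in H2.
assert (H3 : IZR (Qfloor alpha) <> Q2R alpha).
{ intros H3; apply Hint; exists (Qfloor alpha); apply eqR_Qeq; rewrite <- H3.
  unfold inject_Z, Q2R; simpl; field. }
lra.
Qed.

Lemma regular_not_integer (x : R) (z : Z) : IZR z < x < IZR (z + 1) -> regular x.
Proof.
intros Hx n; rewrite INR_IZR_INZ; intros H.
assert (E : x = IZR (- Z.of_nat n)) by (rewrite opp_IZR; lra).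
rewrite E in Hx; destruct Hx as [H1 H2]; apply lt_IZR in H1; apply lt_IZR in H2; lia.
Qed.

Lemma Qdenom_spec (a : Q) : exists z : Z, INR (Qdenom a) * Q2R a = IZR z.
Proof.
exists (Qnum (Qred a)).
rewrite <- (Qeq_eqR _ _ (Qred_correct a)).
unfold Qdenom; rewrite INR_IZR_INZ, positive_nat_Z; unfold Q2R.
field; apply not_0_IZR; lia.
Qed.

Lemma cos_sin_2PI_IZR (z : Z) : cos (2 * PI * IZR z) = 1 /\ sin (2 * PI * IZR z) = 0.
Proof.
assert (Hs : sin (IZR z * PI) = 0) by (apply sin_eq_0_1; now exists z).
replace (2 * PI * IZR z) with (2 * (IZR z * PI)) by ring.
rewrite cos_2a_sin, sin_2a, Hs; split; ring.
Qed.

Lemma is_half_integer_Qfrac (alpha : Q) : ~ is_integer alpha ->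
  is_half_integer alpha <-> Q2R (Qfrac alpha) = 1 / 2.
Proof.
intros Hint; destruct (fractional_part_bounds alpha Hint) as [Hb E].
rewrite E in *.
assert (Hhalf : forall m, Q2R (inject_Z m + (1 # 2)) = IZR m + 1 / 2).
{ intros m; rewrite Q2R_plus; unfold inject_Z, Q2R; simpl; field. }
split.
- intros [m Hm]; apply Qeq_eqR in Hm; rewrite Hhalf in Hm; rewrite Hm in *.
  assert (Em : m = Qfloor alpha); [|rewrite Em; ring].
  destruct Hb as [H1 H2].
  assert (m < Qfloor alpha + 1)%Z by (apply lt_IZR; rewrite plus_IZR; lra).
  assert (Qfloor alpha < m + 1)%Z by (apply lt_IZR; rewrite plus_IZR; lra).
  lia.
- intros H; exists (Qfloor alpha); apply eqR_Qeq; rewrite Hhalf; lra.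
Qed.

Theorem corollary3 :
  forall (k : nat) (alpha : Q),
    (1 <= k)%nat -> ~ is_integer alpha ->
    let alpha_t : R := Q2R (Qfrac alpha) in
    let q : nat := Qdenom (Qfrac alpha) in
    let S : R :=
      sum_n_m (fun s : nat =>
        bernoulli (k + 1) (INR s / INR q)
        * f_trig (k + 1) (2 * PI * INR s * alpha_t)) 1 q in
    polygamma k (1 - Q2R alpha) + (-1) ^ (k + 1) * polygamma k (Q2R alpha)
      = - (-1) ^ ((k + 1) / 2)
        * ((2 * PI * INR q) ^ (k + 1) / (INR q * INR (k + 1))) * S
    /\ (S = 0 <-> is_half_integer alpha /\ Nat.Even k).
Proof.
intros k alpha Hk Hint alpha_t q S.
destruct (fractional_part_bounds alpha Hint) as [Hx Ex]; fold alpha_t in Hx, Ex.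
assert (Hq : (0 < q)%nat) by (unfold q, Qdenom; lia).
destruct (Qdenom_spec (Qfrac alpha)) as [z Hz]; fold q alpha_t in Hz.
destruct (cos_sin_2PI_IZR z) as [Hcos Hsin].
rewrite <- Hz in Hcos, Hsin.
replace (2 * PI * (INR q * alpha_t)) with (INR q * (2 * PI * alpha_t)) in Hcos, Hsin by ring.
pose proof (sum_bernoulli_trig q k alpha_t Hk Hq Hx Hcos Hsin) as Hmain.
assert (ES : sum_n_m (fun s => bernoulli (k + 1) (INR s / INR q)
   * f_trig (k + 1) (INR s * (2 * PI * alpha_t))) 1 q = S).
{ apply sum_n_m_ext; intros s; do 2 f_equal; ring. }
rewrite ES in Hmain; split.
- rewrite <- Hmain.
  rewrite <- (bilateral_period (k + 1) alpha_t (Qfloor alpha)) by lia.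
  replace (alpha_t + IZR (Qfloor alpha)) with (Q2R alpha) by lra.
  rewrite !polygamma_hurwitz; try assumption.
  + unfold bilateral.
    assert (Hs : (-1) ^ (k + 1) * (-1) ^ (k + 1) = 1).
    { rewrite <- Rpow_mult_distr; replace (-1 * -1) with 1 by ring; apply pow1. }
    transitivity (INR (fact k) * ((-1) ^ (k + 1) * hurwitz (k + 1) (1 - Q2R alpha)
      + ((-1) ^ (k + 1) * (-1) ^ (k + 1)) * hurwitz (k + 1) (Q2R alpha))); [ring|].
    rewrite Hs; ring.
  + apply (regular_not_integer _ (Qfloor alpha)); rewrite plus_IZR; lra.
  + apply (regular_not_integer _ (- Qfloor alpha)); rewrite plus_IZR, opp_IZR; lra.
- assert (HqR : 0 < INR q) by now apply lt_0_INR.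
  assert (HkR : 0 < INR (k + 1)) by (apply lt_0_INR; lia).
  pose proof PI_RGT_0.
  rewrite (is_half_integer_Qfrac alpha Hint).
  assert (Hpar : Nat.Even k <-> Nat.Odd (k + 1)) by (rewrite Nat.add_1_r; symmetry; apply Nat.Odd_succ).
  rewrite Hpar; fold alpha_t.
  rewrite <- (bilateral_eq_0 (k + 1) alpha_t) by (lia || lra).
  split; intros H0.
  + rewrite H0, Rmult_0_r in Hmain; apply Rmult_integral in Hmain.
    destruct Hmain as [H1|H1]; [now apply INR_fact_neq_0 in H1|assumption].
  + rewrite H0, Rmult_0_r in Hmain; symmetry in Hmain.
    apply Rmult_integral in Hmain; destruct Hmain as [H1|H1]; [exfalso|assumption].
    apply Rmult_integral in H1; destruct H1 as [H1|H1]; revert H1.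
    * apply Ropp_neq_0_compat, pow_nonzero; lra.
    * apply Rgt_not_eq, Rdiv_lt_0_compat; [apply pow_lt|];
        [apply Rmult_lt_0_compat|]; try apply Rmult_lt_0_compat; lra.
Qed.
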